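(* Let $G$ and $H$ be finite groups. (a) Assume that $\gamma\in B^\Delta(G,H)$ satisfies $\gamma\cdot_H\gamma^\circ=[G]$ in $B^\Delta(G,G)$. Then also $\gamma^\circ\cdot_G\gamma=[H]$ in $B^\Delta(H,H)$. In particular $\gamma\in B^\Delta_\circ(G,H)$. (b) The set $B^\Delta_\circ(G,H)$ is finite. (c) The set $B^\Delta_\circ(G,H)$ is non-empty if and only if $G$ is isomorphic to $H$. (d) For each $\gamma\in B^\Delta_\circ(G,H)$ there exists an isomorphism $\phi\colon H\to G$, unique up to composition with inner automorphisms of $G$, such that $[(G\times H)/\Delta(G,\phi,H)]$ occurs in $\gamma$. Moreover, if $G$ is nilpotent then each $\gamma\in B^\Delta_\circ(G,H)$ is uniform. (e) If $G$ is nilpotent then the group $B^\Delta_\circ(G,G)$ (with multiplication $\cdot_G$) is isomorphic to the semidirect product $B(G)^\times\rtimes\mathrm{Out}(G)$ with respect to the natural action of $\mathrm{Out}(G)$ on $B(G)^\times$.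
   Context: All groups are finite. For groups $G,H$, subgroups $R\le G$, $S\le H$ and an isomorphism $\alpha\colon S\to R$, put $\Delta(R,\alpha,S)=\{(\alpha(s),s)\mid s\in S\}\le G\times H$; subgroups of this form are called twisted diagonal. $B(G)$ is the Burnside ring of $G$ (Grothendieck ring of finite left $G$-sets with respect to disjoint union and direct product), with unit group $B(G)^\times$. $B(G,H)$ is the Grothendieck group (with respect to disjoint union) of finite $(G,H)$-bisets (sets with commuting left $G$-action and right $H$-action), identified with left $(G\times H)$-sets via $(g,h)\cdot x=gxh^{-1}$. $B^\Delta(G,H)\subseteq B(G,H)$ is the Grothendieck group of bifree bisets (free as left $G$-set and free as right $H$-set). It has the standard $\mathbb{Z}$-basis of elements $[(G\times H)/L]$, with $L$ running over representatives of the $(G\times H)$-conjugacy classes of twisted diagonal subgroups of $G\times H$. A standard basis element occurs in $\gamma$ if its coefficient in $\gamma$ is non-zero. The tensor product of bisets $X\times_H Y$ (the set of orbits of $X\times Y$ under $h\cdot(x,y)=(xh^{-1},hy)$) induces bilinear maps $-\cdot_H-\colon B^\Delta(G,H)\times B^\Delta(H,K)\to B^\Delta(G,K)$. For $G=H=K$ this gives a ring structure on $B^\Delta(G,G)$ with identity $[G]=[(G\times G)/\Delta(G,\mathrm{id}_G,G)]$, where $G$ is viewed as a $(G,G)$-biset by left and right multiplication. The isomorphism $-^\circ\colon B^\Delta(G,H)\to B^\Delta(H,G)$ is given by $[(G\times H)/L]\mapsto[(H\times G)/L^\circ]$ with $L^\circ=\{(h,g)\mid(g,h)\in L\}$. $B^\Delta_\circ(G,H)$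 is the set of all $\gamma\in B^\Delta(G,H)$ with $\gamma\cdot_H\gamma^\circ=[G]$ in $B^\Delta(G,G)$ and $\gamma^\circ\cdot_G\gamma=[H]$ in $B^\Delta(H,H)$. For $G=H$ it is a group under $\cdot_G$ (the group of orthogonal units). An element $\gamma\in B^\Delta(G,H)$ is called uniform if there exists an isomorphism $\phi\colon H\to G$ such that $\gamma$ lies in the $\mathbb{Z}$-span of the elements $[(G\times H)/\Delta(\phi(V),\phi,V)]$, $V\le H$ (here $\phi$ is restricted to $V$). $\mathrm{Out}(G)$ is the outer automorphism group; it acts on $B(G)$ by ring automorphisms via ${}^{\overline{\phi}}[G/R]=[G/\phi(R)]$, where $\overline{\phi}$ is the class of $\phi\in\mathrm{Aut}(G)$ and $R\le G$, and hence it acts on the group $B(G)^\times$ (the natural action). *)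

(* Defs.v *)
From HB Require Import structures.
From mathcomp Require Import all_boot all_order all_algebra all_fingroup.
From mathcomp Require Import all_solvable.
From mathcomp Require Import generic_quotient boolp.

Set Implicit Arguments.
Unset Strict Implicit.
Unset Printing Implicit Defensive.

Import GRing.Theory.
Local Open Scope quotient_scope.
Local Open Scope ring_scope.

Section Grothendieck.
Variable M : nmodType.

Definition groth_rel (p q : M * M) : bool :=
  `[< exists z, p.1 + q.2 + z = q.1 + p.2 + z >].

Lemma groth_rel_refl : reflexive groth_rel.
Proof. by move=> p; apply/asboolP; exists 0. Qed.

Lemma groth_rel_sym : symmetric groth_rel.
Proof.
by move=> p q; apply: asbool_equiv_eq; split=> -[z e]; exists z; rewrite e.
Qed.

Lemma groth_rel_trans : transitive groth_rel.
Proof.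
move=> q p r /asboolP[z e] /asboolP[w f]; apply/asboolP.
exists (z + w + (q.1 + q.2)).
transitivity ((p.1 + q.2 + z) + (q.1 + r.2 + w)).
  by rewrite (AC (2*(2*2)) ((1*6*3)*(5*2*4))).
rewrite e f.
by rewrite (AC (3*3) ((4*2)*((3*6)*(1*5)))).
Qed.

Canonical groth_equiv :=
  EquivRel groth_rel groth_rel_refl groth_rel_sym groth_rel_trans.

Definition groth := {eq_quot groth_equiv}.
HB.instance Definition _ := Choice.on groth.
HB.instance Definition _ := EqQuotient.on groth.

Definition gdiff (x y : M) : groth := \pi_groth (x, y).

Lemma gdiffP (x y x' y' : M) :
  gdiff x y = gdiff x' y' <-> exists z, x + y' + z = x' + y + z.
Proof.
split=> [/eqmodP/asboolP //|h]; apply/eqmodP; exact/asboolP.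
Qed.

Lemma gdiff_repr (u : groth) : u = gdiff (repr u).1 (repr u).2.
Proof. by rewrite /gdiff -surjective_pairing reprK. Qed.

Definition groth_add (u v : groth) : groth :=
  gdiff ((repr u).1 + (repr v).1) ((repr u).2 + (repr v).2).
Definition groth_opp (u : groth) : groth := gdiff (repr u).2 (repr u).1.

Lemma groth_addE x y x' y' :
  groth_add (gdiff x y) (gdiff x' y') = gdiff (x + x') (y + y').
Proof.
have [/gdiffP[z e] /gdiffP[z' e']] :=
  (gdiff_repr (gdiff x y), gdiff_repr (gdiff x' y')).
apply/esym/gdiffP; exists (z + z').
set a := repr _ in e; set b := repr _ in e'.
transitivity ((x + a.2 + z) + (x' + b.2 + z')).
  by rewrite (AC (2*2*2) ((1*3*5)*(2*4*6))).
rewrite e e'.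
by rewrite (AC (3*3) ((1*4)*(2*5)*(3*6))).
Qed.

Lemma groth_oppE x y : groth_opp (gdiff x y) = gdiff y x.
Proof.
have /gdiffP[z e] := gdiff_repr (gdiff x y).
apply/gdiffP; exists z; set a := repr _ in e *.
by rewrite [_ + x]addrC e addrC [y + _]addrC addrC.
Qed.

Fact groth_addA : associative groth_add.
Proof.
move=> u v w; rewrite (gdiff_repr u) (gdiff_repr v) (gdiff_repr w).
by rewrite !groth_addE !addrA.
Qed.

Fact groth_addC : commutative groth_add.
Proof. by move=> u v; rewrite /groth_add addrC [X in gdiff _ X]addrC. Qed.

Fact groth_add0 : left_id (gdiff 0 0) groth_add.
Proof. by move=> u; rewrite (gdiff_repr u) groth_addE !add0r. Qed.

Fact groth_addN : left_inverse (gdiff 0 0) groth_opp groth_add.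
Proof.
move=> u; rewrite (gdiff_repr u) groth_oppE groth_addE.
by apply/gdiffP; exists 0; rewrite !addr0 add0r addrC.
Qed.

HB.instance Definition _ :=
  GRing.isZmodule.Build groth groth_addA groth_addC groth_add0 groth_addN.

Definition gcl (x : M) : groth := gdiff x 0.

Lemma gclD x y : gcl (x + y) = gcl x + gcl y.
Proof. by rewrite [RHS]groth_addE addr0. Qed.

Lemma gdiffE x y : gdiff x y = gcl x - gcl y.
Proof.
transitivity (groth_add (gcl x) (groth_opp (gcl y))) => //.
by rewrite groth_oppE groth_addE addr0 add0r.
Qed.

Lemma grothE (u : groth) : u = gcl (repr u).1 - gcl (repr u).2.
Proof. by rewrite -gdiffE -gdiff_repr. Qed.

Lemma gclP x y : gcl x = gcl y <-> exists z, x + z = y + z.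
Proof. by split=> [/gdiffP|h]; [|apply/gdiffP]; rewrite ?addr0. Qed.

Definition gext (A : zmodType) (f : M -> A) (u : groth) : A :=
  f (repr u).1 - f (repr u).2.

Section Ext.
Variables (A : zmodType) (f : M -> A).
Hypothesis fD : {morph f : x y / x + y}.

Lemma gext_diff x y : gext f (gdiff x y) = f x - f y.
Proof.
have /gdiffP[z e] := gdiff_repr (gdiff x y); rewrite /gext.
set a := repr _ in e *; apply/eqP; rewrite subr_eq addrAC -addrA.
rewrite eq_sym addrA subr_eq -!fD; apply/eqP/(@addIr _ (f z)).
by rewrite -!fD e.
Qed.

Lemma gext_cl x : gext f (gcl x) = f x.
Proof.
rewrite gext_diff; have: f 0 + f 0 = f 0 by rewrite -fD addr0.
by move/eqP; rewrite -subr_eq0 addrK => /eqP->; rewrite subr0.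
Qed.

Lemma gextD : {morph gext f : u v / u + v}.
Proof.
move=> u v; rewrite {1}(gdiff_repr u) {1}(gdiff_repr v).
by rewrite [_ + _]groth_addE gext_diff !fD opprD addrACA.
Qed.
End Ext.

Lemma morphN (A B : zmodType) (f : A -> B) :
  {morph f : x y / x + y} -> {morph f : x / - x}.
Proof.
move=> fD x; have f0 : f 0 = 0 by apply: (@addrI _ (f 0)); rewrite -fD !addr0.
by apply: (@addrI _ (f x)); rewrite -fD !subrr.
Qed.

Lemma groth_ext (A : zmodType) (f g : groth -> A) :
  {morph f : x y / x + y} -> {morph g : x y / x + y} ->
  (forall x, f (gcl x) = g (gcl x)) -> f =1 g.
Proof.
move=> fD gD fg u; rewrite (grothE u) fD gD.
by rewrite (morphN fD) (morphN gD) !fg.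
Qed.

End Grothendieck.

Section Bilinear.
Variables (M N : nmodType) (A : zmodType) (f : M -> N -> A).
Hypothesis fDl : forall n, {morph f^~ n : x y / x + y}.
Hypothesis fDr : forall m, {morph f m : x y / x + y}.

Definition gext2 (u : groth M) (v : groth N) : A :=
  gext (fun m => gext (f m) v) u.

Fact gext2_aux v : {morph (fun m => gext (f m) v) : x y / x + y}.
Proof. by move=> x y; rewrite /gext !fDl opprD addrACA. Qed.

Lemma gext2_cl x y : gext2 (gcl x) (gcl y) = f x y.
Proof. by rewrite /gext2 gext_cl ?gext_cl//; exact: gext2_aux. Qed.

Lemma gext2Dl v : {morph gext2^~ v : x y / x + y}.
Proof. exact/gextD/gext2_aux. Qed.

Lemma gext2Dr u : {morph gext2 u : x y / x + y}.
Proof.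
move=> x y; transitivity
  (gext (f (repr u).1) (x + y) - gext (f (repr u).2) (x + y)) => //.
by rewrite !gextD// opprD addrACA.
Qed.
End Bilinear.

Section GrothRing.
Variable M : comPzSemiRingType.

Definition groth_mul : groth M -> groth M -> groth M :=
  gext2 (fun x y => gcl (x * y)).

Fact gmul_auxl (n : M) : {morph (fun x => gcl (x * n)) : x y / x + y}.
Proof. by move=> x y; rewrite mulrDl gclD. Qed.
Fact gmul_auxr (m : M) : {morph (fun x => gcl (m * x)) : x y / x + y}.
Proof. by move=> x y; rewrite mulrDr gclD. Qed.

Lemma groth_mul_cl x y : groth_mul (gcl x) (gcl y) = gcl (x * y).
Proof. exact: gext2_cl gmul_auxl gmul_auxr _ _. Qed.
Fact groth_mulDl : left_distributive groth_mul +%R.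
Proof. by move=> u v w; apply: (gext2Dl gmul_auxl). Qed.
Fact groth_mulDr : right_distributive groth_mul +%R.
Proof. by move=> u v w; apply: (gext2Dr gmul_auxr). Qed.

Fact groth_mulC : commutative groth_mul.
Proof.
move=> u v; move: u; apply: groth_ext => [x y|x y|x].
- exact: groth_mulDl.
- exact: groth_mulDr.
move: v; apply: groth_ext => [y z|y z|y].
- exact: groth_mulDr.
- exact: groth_mulDl.
by rewrite !groth_mul_cl mulrC.
Qed.

Fact groth_mulA : associative groth_mul.
Proof.
move=> u v w; move: u; apply: groth_ext => [x y|x y|x].
- exact: groth_mulDl.
- by rewrite !groth_mulDl.
move: v; apply: groth_ext => [y z|y z|y].
- by rewrite !(groth_mulDl,groth_mulDr).
- by rewrite !(groth_mulDl,groth_mulDr).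
move: w; apply: groth_ext => [z t|z t|z].
- by rewrite !(groth_mulDl,groth_mulDr).
- by rewrite !(groth_mulDl,groth_mulDr).
by rewrite !groth_mul_cl mulrA.
Qed.

Fact groth_mul1 : left_id (gcl 1) groth_mul.
Proof.
apply: groth_ext => [x y|x y|x] //; first exact: groth_mulDr.
by rewrite groth_mul_cl mul1r.
Qed.

HB.instance Definition _ := GRing.Zmodule_isComPzRing.Build (groth M)
  groth_mulA groth_mulC groth_mul1 groth_mulDl.

Lemma gclM (x y : M) : gcl (x * y) = gcl x * gcl y.
Proof. by rewrite [RHS]groth_mul_cl. Qed.
End GrothRing.

Definition is_lact (G : finGroupType) (T : Type) (a : G -> T -> T) : Prop :=
  (forall x, a 1%g x = x) /\ (forall g h x, a (g * h)%g x = a g (a h x)).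

Record lact (G : finGroupType) (T : Type) := Lact {
  lact_fun :> G -> T -> T;
  lact_fun_is_lact : is_lact lact_fun
}.

Section LactTheory.
Variables (G : finGroupType) (T : Type) (a : lact G T).

Lemma lact1 x : a 1%g x = x.
Proof. by have [h _] := lact_fun_is_lact a. Qed.
Lemma lactM g h x : a (g * h)%g x = a g (a h x).
Proof. by have [_ ->] := lact_fun_is_lact a. Qed.
Lemma lactK g : cancel (a g) (a g^-1%g).
Proof. by move=> x; rewrite -lactM mulVg lact1. Qed.
Lemma lactKV g : cancel (a g^-1%g) (a g).
Proof. by move=> x; rewrite -lactM mulgV lact1. Qed.
Lemma lact_inj g : injective (a g).
Proof. exact: can_inj (lactK g). Qed.
End LactTheory.

Definition lact_iso (G : finGroupType) (T U : Type) (a : lact G T)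
    (b : lact G U) : Prop :=
  exists f : T -> U, bijective f /\ (forall g x, f (a g x) = b g (f x)).

Section LactIso.
Variable G : finGroupType.

Lemma lact_iso_refl T (a : lact G T) : lact_iso a a.
Proof. by exists id; split=> //; exists id. Qed.

Lemma lact_iso_sym T U (a : lact G T) (b : lact G U) :
  lact_iso a b -> lact_iso b a.
Proof.
case=> f [[f' fK f'K] fE]; exists f'; split; first by exists f.
by move=> g y; apply: (can_inj fK); rewrite fE !f'K.
Qed.

Lemma lact_iso_trans T U V (a : lact G T) (b : lact G U) (c : lact G V) :
  lact_iso a b -> lact_iso b c -> lact_iso a c.
Proof.
case=> f [fb fE] [f' [fb' fE']]; exists (f' \o f); split.
  exact: bij_comp.
by move=> g x /=; rewrite fE fE'.
Qed.

Lemma lact_isoP (T U : finType) (a : lact G T) (b : lact G U) (f : T -> U) :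
  injective f -> (forall y, exists x, f x = y) ->
  (forall g x, f (a g x) = b g (f x)) -> lact_iso a b.
Proof.
move=> fi fs fE; exists f; split=> //.
have fs' y : exists x, f x == y by have [x <-] := fs y; exists x.
exists (fun y => xchoose (fs' y)) => x; last exact/eqP/(xchooseP (fs' x)).
by apply: fi; apply/eqP/(xchooseP (fs' (f x))).
Qed.

End LactIso.

(* Every finite G-set is isomorphic to one with underlying set 'I_n, so the
   isomorphism classes of the latter exhaust the finite G-sets. *)
Definition gset_on (G : finGroupType) (n : nat) : Type :=
  {a : {ffun G -> {ffun 'I_n -> 'I_n}} | `[< is_lact (fun g x => a g x) >]}.
HB.instance Definition _ G n := Choice.on (gset_on G n).

Definition gset (G : finGroupType) : Type := {n : nat & gset_on G n}.
HB.instance Definition _ G := Choice.on (gset G).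

Section GSets.
Variable G : finGroupType.

Definition gset_carrier (X : gset G) : finType := 'I_(tag X).

Definition gact (X : gset G) : lact G (gset_carrier X) :=
  Lact (asboolW (valP (tagged X))).

Section OfLact.
Variables (T : finType) (a : lact G T).

Definition ord_act : {ffun G -> {ffun 'I_#|T| -> 'I_#|T|}} :=
  [ffun g => [ffun i => enum_rank (a g (enum_val i))]].

Fact ord_act_is_lact : `[< is_lact (fun g x => ord_act g x) >].
Proof.
apply/asboolP; split=> [x|g h x]; rewrite !ffunE.
  by rewrite lact1 enum_valK.
by rewrite enum_rankK lactM.
Qed.

Definition gset_of : gset G :=
  Tagged (gset_on G) (Sub ord_act ord_act_is_lact : gset_on G #|T|).

Lemma gset_of_iso : lact_iso a (gact gset_of).
Proof.
exists enum_rank; split; first exact: enum_rank_bij.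
by move=> g x; rewrite /= !ffunE enum_rankK.
Qed.
End OfLact.

Definition gset_iso (X Y : gset G) : bool := `[< lact_iso (gact X) (gact Y) >].

Lemma gset_iso_refl : reflexive gset_iso.
Proof. by move=> X; apply/asboolP/lact_iso_refl. Qed.
Lemma gset_iso_sym : symmetric gset_iso.
Proof.
by move=> X Y; apply: asbool_equiv_eq; split=> /lact_iso_sym.
Qed.
Lemma gset_iso_trans : transitive gset_iso.
Proof.
by move=> Y X Z /asboolP h /asboolP k; apply/asboolP/(lact_iso_trans h k).
Qed.

Canonical gset_iso_equiv :=
  EquivRel gset_iso gset_iso_refl gset_iso_sym gset_iso_trans.

Definition gclass := {eq_quot gset_iso_equiv}.
HB.instance Definition _ := Choice.on gclass.
HB.instance Definition _ := EqQuotient.on gclass.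

Definition cls (T : finType) (a : lact G T) : gclass := \pi_gclass (gset_of a).

Lemma clsP (T U : finType) (a : lact G T) (b : lact G U) :
  cls a = cls b <-> lact_iso a b.
Proof.
split=> [/eqmodP/asboolP h|h].
  apply: lact_iso_trans (gset_of_iso a) (lact_iso_trans h _).
  exact/lact_iso_sym/gset_of_iso.
apply/eqmodP/asboolP; apply: lact_iso_trans (lact_iso_trans _ h) _.
  exact/lact_iso_sym/gset_of_iso.
exact: gset_of_iso.
Qed.

Lemma cls_repr (x : gclass) : x = cls (gact (repr x)).
Proof.
by rewrite -{1}[x]reprK; apply/eqmodP/asboolP/gset_of_iso.
Qed.

Section Constructions.
Variables (T U : Type) (a : lact G T) (b : lact G U).

Definition sum_fun (g : G) (x : T + U) : T + U :=
  match x with inl y => inl (a g y) | inr y => inr (b g y) end.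
Fact sum_is_lact : is_lact sum_fun.
Proof. by split=> [[]|g h []] x /=; rewrite ?lact1 ?lactM. Qed.
Definition sum_lact := Lact sum_is_lact.

Definition prod_fun (g : G) (x : T * U) : T * U := (a g x.1, b g x.2).
Fact prod_is_lact : is_lact prod_fun.
Proof.
by split=> [[]|g h []] x y; rewrite /prod_fun /= ?lact1 ?lactM.
Qed.
Definition prod_lact := Lact prod_is_lact.
End Constructions.

Fact triv_is_lact T : is_lact (fun (_ : G) (x : T) => x).
Proof. by []. Qed.
Definition triv_lact T := Lact (@triv_is_lact T).

Lemma sum_lact_iso T U T' U' (a : lact G T) (b : lact G U) (a' : lact G T')
    (b' : lact G U') :
  lact_iso a a' -> lact_iso b b' -> lact_iso (sum_lact a b) (sum_lact a' b').
Proof.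
case=> f [[fi fK fiK] fE] [h [[hi hK hiK] hE]].
exists (fun x => match x with inl y => inl (f y) | inr y => inr (h y) end).
split; last by move=> g [] x /=; rewrite ?fE ?hE.
exists (fun x => match x with inl y => inl (fi y) | inr y => inr (hi y) end);
by case=> x; rewrite ?fK ?hK ?fiK ?hiK.
Qed.

Lemma prod_lact_iso T U T' U' (a : lact G T) (b : lact G U) (a' : lact G T')
    (b' : lact G U') :
  lact_iso a a' -> lact_iso b b' -> lact_iso (prod_lact a b) (prod_lact a' b').
Proof.
case=> f [[fi fK fiK] fE] [h [[hi hK hiK] hE]].
exists (fun x => (f x.1, h x.2)).
split; last by move=> g [x y] /=; rewrite /prod_fun /= fE hE.
by exists (fun x => (fi x.1, hi x.2)) => -[x y] /=; rewrite ?fK ?hK ?fiK ?hiK.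
Qed.

Definition gclass_add (x y : gclass) : gclass :=
  cls (sum_lact (gact (repr x)) (gact (repr y))).
Definition gclass_mul (x y : gclass) : gclass :=
  cls (prod_lact (gact (repr x)) (gact (repr y))).
Definition gclass0 : gclass := cls (triv_lact void).
Definition gclass1 : gclass := cls (triv_lact unit).

Lemma cls_gact (T : finType) (a : lact G T) : lact_iso (gact (repr (cls a))) a.
Proof. by apply/clsP; rewrite -cls_repr. Qed.

Lemma gclass_addE (T U : finType) (a : lact G T) (b : lact G U) :
  gclass_add (cls a) (cls b) = cls (sum_lact a b).
Proof. by apply/clsP/sum_lact_iso; apply: cls_gact. Qed.

Lemma gclass_mulE (T U : finType) (a : lact G T) (b : lact G U) :
  gclass_mul (cls a) (cls b) = cls (prod_lact a b).
Proof. by apply/clsP/prod_lact_iso; apply: cls_gact. Qed.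

Fact gclass_addA : associative gclass_add.
Proof.
move=> x y z; rewrite (cls_repr x) (cls_repr y) (cls_repr z) !gclass_addE.
apply/clsP; exists (fun s => match s with
  | inl u => inl (inl u) | inr (inl u) => inl (inr u) | inr (inr u) => inr u
  end); split; last by move=> g [|[]].
by exists (fun s => match s with
  | inl (inl u) => inl u | inl (inr u) => inr (inl u) | inr u => inr (inr u)
  end) => [[|[]]|[[]|]].
Qed.

Fact gclass_addC : commutative gclass_add.
Proof.
move=> x y; rewrite (cls_repr x) (cls_repr y) !gclass_addE.
apply/clsP; exists (fun s => match s with inl u => inr u | inr u => inl u end).
split; last by move=> g [].
by exists (fun s => match s with inl u => inr u | inr u => inl u end) => -[].
Qed.

Fact gclass_add0 : left_id gclass0 gclass_add.
Proof.
move=> x; rewrite (cls_repr x) gclass_addE.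
apply/clsP; exists (fun s => match s with
  | inl u => match u : void with end | inr u => u end).
split; last by move=> g [[]|].
by exists (fun u => inr u) => // -[[]|].
Qed.

Fact gclass_mulA : associative gclass_mul.
Proof.
move=> x y z; rewrite (cls_repr x) (cls_repr y) (cls_repr z) !gclass_mulE.
apply/clsP; exists (fun s => ((s.1, s.2.1), s.2.2)); split=> //.
by exists (fun s => (s.1.1, (s.1.2, s.2))) => [[? []]|[[]]].
Qed.

Fact gclass_mulC : commutative gclass_mul.
Proof.
move=> x y; rewrite (cls_repr x) (cls_repr y) !gclass_mulE.
apply/clsP; exists (fun s => (s.2, s.1)); split=> //.
by exists (fun s => (s.2, s.1)) => -[].
Qed.

Fact gclass_mul1 : left_id gclass1 gclass_mul.
Proof.
move=> x; rewrite (cls_repr x) gclass_mulE.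
apply/clsP; exists snd; split=> //.
by exists (fun s => (tt, s)) => // -[[]].
Qed.

Fact gclass_mulDl : left_distributive gclass_mul gclass_add.
Proof.
move=> x y z; rewrite (cls_repr x) (cls_repr y) (cls_repr z).
rewrite !(gclass_mulE, gclass_addE); apply/clsP.
exists (fun s => match s.1 with inl u => inl (u, s.2) | inr u => inr (u, s.2)
  end); split; last by move=> g [[]].
by exists (fun s => match s with inl u => (inl u.1, u.2)
  | inr u => (inr u.1, u.2) end) => [[[]]|[[]|[]]].
Qed.

Fact gclass_mul0 : left_zero gclass0 gclass_mul.
Proof.
move=> x; rewrite (cls_repr x) gclass_mulE; apply/clsP.
exists fst; split=> //; exists (fun u => match u : void with end); by case.
Qed.

HB.instance Definition _ := GRing.isNmodule.Build gclass
  gclass_addA gclass_addC gclass_add0.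
HB.instance Definition _ := GRing.Nmodule_isComPzSemiRing.Build gclass
  gclass_mulA gclass_mulC gclass_mul1 gclass_mulDl gclass_mul0.

Lemma clsD (T U : finType) (a : lact G T) (b : lact G U) :
  cls (sum_lact a b) = cls a + cls b.
Proof. by rewrite [RHS]gclass_addE. Qed.
Lemma clsM (T U : finType) (a : lact G T) (b : lact G U) :
  cls (prod_lact a b) = cls a * cls b.
Proof. by rewrite [RHS]gclass_mulE. Qed.

End GSets.

Definition burnside (G : finGroupType) := groth (gclass G).
HB.instance Definition _ G := GRing.ComPzRing.on (burnside G).

Section BurnsideUnits.
Variable G : finGroupType.

Fact burnside_oner_neq0 : (1 : burnside G) != 0.
Proof.
apply/eqP => /gclP[z]; rewrite (cls_repr z) => /esym.
rewrite -[0]/(gclass0 G) -[1]/(gclass1 G) -!clsD => /clsP[f [fb _]].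
have := bij_eq_card fb; rewrite !card_sum card_unit card_void add0n add1n.
by move/eqP; rewrite eqn_leq ltnn andbF.
Qed.

HB.instance Definition _ :=
  GRing.PzSemiRing_isNonZero.Build (burnside G) burnside_oner_neq0.

Definition burnside_unit : {pred burnside G} :=
  fun u => `[< exists v, v * u == 1 >].

Definition burnside_inv (u : burnside G) : burnside G :=
  match pselect (exists v, v * u == 1) with
  | left h => xchoose h
  | right _ => u
  end.

Fact burnside_mulVx : {in burnside_unit, left_inverse 1 burnside_inv *%R}.
Proof.
move=> u /asboolP h; rewrite /burnside_inv; case: pselect => // k.
exact/eqP/(xchooseP k).
Qed.

Fact burnside_unitPl (u v : burnside G) : v * u = 1 -> burnside_unit u.
Proof. by move=> e; apply/asboolP; exists v; apply/eqP. Qed.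

Fact burnside_invr_out : {in [predC burnside_unit], burnside_inv =1 id}.
Proof.
by move=> u /asboolP h; rewrite /burnside_inv; case: pselect.
Qed.

HB.instance Definition _ := GRing.ComNzRing_hasMulInverse.Build (burnside G)
  burnside_mulVx burnside_unitPl burnside_invr_out.
End BurnsideUnits.

Section UnitGroup.
Variable R : comUnitRingType.

Definition unit_group := {u : R | u \is a GRing.unit}.
HB.instance Definition _ := Choice.on unit_group.

Definition unit_one : unit_group := Sub 1 (unitr1 R).
Definition unit_inv (u : unit_group) : unit_group :=
  Sub (val u)^-1 (etrans (unitrV _) (valP u)).
Fact unit_mul_subproof (u v : unit_group) : val u * val v \is a GRing.unit.
Proof. by rewrite unitrM (valP u) (valP v). Qed.
Definition unit_mul (u v : unit_group) : unit_group :=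
  Sub (val u * val v) (unit_mul_subproof u v).

Fact unit_mulA : associative unit_mul.
Proof. by move=> u v w; apply: val_inj; rewrite /= mulrA. Qed.
Fact unit_mul1 : left_id unit_one unit_mul.
Proof. by move=> u; apply: val_inj; rewrite /= mul1r. Qed.
Fact unit_mulr1 : right_id unit_one unit_mul.
Proof. by move=> u; apply: val_inj; rewrite /= mulr1. Qed.
Fact unit_mulV : left_inverse unit_one unit_inv unit_mul.
Proof. by move=> u; apply: val_inj; rewrite /= mulVr ?(valP u). Qed.
Fact unit_mulrV : right_inverse unit_one unit_inv unit_mul.
Proof. by move=> u; apply: val_inj; rewrite /= mulrV ?(valP u). Qed.
HB.instance Definition _ := isGroup.Build unit_group
  unit_mulA unit_mul1 unit_mulr1 unit_mulV unit_mulrV.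
End UnitGroup.

Section Cosets.
Variables (G : finGroupType) (L : {set G}).

Definition coset_space := {A : {set G} | A \in lcosets L [set: G]}.
HB.instance Definition _ := Finite.on coset_space.

Fact coset_fun_subproof (g : G) (A : coset_space) :
  (g *: val A)%g \in lcosets L [set: G].
Proof.
case: A => A /= /lcosetsP[x _ ->]; apply/lcosetsP; exists (g * x)%g.
  by rewrite inE.
by rewrite lcosetM.
Qed.

Definition coset_fun (g : G) (A : coset_space) : coset_space :=
  Sub (g *: val A)%g (coset_fun_subproof g A).

Fact coset_is_lact : is_lact coset_fun.
Proof.
split=> [A|g h A]; apply: val_inj => /=; first by rewrite lcoset1.
by rewrite lcosetM.
Qed.
Definition coset_lact := Lact coset_is_lact.

(* The element [G/L]. *)
Definition coset_elt : burnside G := gcl (cls coset_lact).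
End Cosets.

Lemma cls_coset (G : finGroupType) (L : {group G}) (T : finType)
    (a : lact G T) (x : T) :
  (forall y, exists g, y = a g x) -> (forall g, a g x = x <-> g \in L) ->
  cls a = cls (coset_lact L).
Proof.
move=> tr st.
have ex (g : G) : (g *: L)%g \in lcosets L [set: G].
  by apply/lcosetsP; exists g; rewrite ?inE.
have tr' y : exists g, y == a g x by have [g ->] := tr y; exists g.
pose f y : coset_space L := Sub (xchoose (tr' y) *: L)%g (ex _).
have fE g : f (a g x) = Sub (g *: L)%g (ex g).
  apply: val_inj => /=; apply/lcoset_eqP; rewrite mem_lcoset.
  have /eqP e := xchooseP (tr' (a g x)); apply/st.
  by rewrite lactM -e lactK.
apply/clsP/(@lact_isoP _ _ _ _ _ f).
- move=> y z; have [g ->] := tr y; have [h ->] := tr z.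
  rewrite !fE => /(congr1 val) /= /lcoset_eqP; rewrite mem_lcoset => /st e.
  by rewrite -{2}e -lactM mulKVg.
- case=> A /= iA; have /lcosetsP[g _ e] := iA; exists (a g x).
  by rewrite fE; apply: val_inj.
move=> g y; have [h ->] := tr y.
by rewrite -lactM !fE; apply: val_inj; rewrite /= lcosetM.
Qed.

Section Restriction.
Variables (K G : finGroupType) (f : {morphism [set: K] >-> G}).

Fact res_is_lact T (a : lact G T) : is_lact (fun k x => a (f k) x).
Proof.
by split=> [x|g h x]; rewrite ?morph1 ?lact1 ?morphM ?inE ?lactM.
Qed.
Definition res_lact T (a : lact G T) : lact K T := Lact (res_is_lact a).

Lemma res_lact_iso T U (a : lact G T) (b : lact G U) :
  lact_iso a b -> lact_iso (res_lact a) (res_lact b).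
Proof. by case=> h [hb hE]; exists h; split=> // k x; apply: hE. Qed.

Definition gclass_res (x : gclass G) : gclass K :=
  cls (res_lact (gact (repr x))).

Lemma gclass_resE (T : finType) (a : lact G T) :
  gclass_res (cls a) = cls (res_lact a).
Proof. by apply/clsP/res_lact_iso/cls_gact. Qed.

Lemma gclass_resD : {morph gclass_res : x y / x + y}.
Proof.
move=> x y; rewrite (cls_repr x) (cls_repr y) -clsD !gclass_resE -clsD.
by apply/clsP; exists id; split; [exists id | move=> g []].
Qed.

Lemma gclass_resM : {morph gclass_res : x y / x * y}.
Proof.
move=> x y; rewrite (cls_repr x) (cls_repr y) -clsM !gclass_resE -clsM.
by apply/clsP/lact_iso_refl.
Qed.

Lemma gclass_res1 : gclass_res 1 = 1.
Proof. by rewrite [LHS]gclass_resE; apply/clsP/lact_iso_refl. Qed.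

Fact gcl_res_add : {morph (fun x => gcl (gclass_res x)) : x y / x + y}.
Proof. by move=> x y; rewrite gclass_resD gclD. Qed.

Definition burnside_res : burnside G -> burnside K :=
  gext (fun x => gcl (gclass_res x)).

Lemma burnside_res_cl x : burnside_res (gcl x) = gcl (gclass_res x).
Proof. exact: gext_cl gcl_res_add x. Qed.

Lemma burnside_resD : {morph burnside_res : u v / u + v}.
Proof. exact: gextD gcl_res_add. Qed.

Lemma burnside_resM : {morph burnside_res : u v / u * v}.
Proof.
move=> u v; move: u; apply: groth_ext => [x y|x y|x].
- by rewrite mulrDl burnside_resD.
- by rewrite burnside_resD mulrDl.
move: v; apply: groth_ext => [y z|y z|y].
- by rewrite mulrDr burnside_resD.
- by rewrite burnside_resD mulrDr.
by rewrite -gclM !burnside_res_cl gclass_resM gclM.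
Qed.

Lemma burnside_res1 : burnside_res 1 = 1.
Proof. by rewrite burnside_res_cl gclass_res1. Qed.
End Restriction.

Lemma eq_burnside_res (K G : finGroupType)
    (f f' : {morphism [set: K] >-> G}) (c : G) :
  (forall k, f' k = f k ^ c)%g -> burnside_res f =1 burnside_res f'.
Proof.
move=> e; apply: groth_ext; try exact: burnside_resD.
move=> x; rewrite !burnside_res_cl; congr gcl.
rewrite (cls_repr x) !gclass_resE; move: (gact _) => a; apply/clsP.
exists (a c^-1)%g; split; first by exists (a c); [apply: lactKV|apply: lactK].
by move=> k y; rewrite /= e conjgE -!lactM -!mulgA mulgV mulg1.
Qed.

Lemma burnside_res_comp (K G F : finGroupType) (f : {morphism [set: K] >-> G})
    (f' : {morphism [set: G] >-> F}) (h : {morphism [set: K] >-> F}) :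
  (forall k, h k = f' (f k)) ->
  forall u, burnside_res h u = burnside_res f (burnside_res f' u).
Proof.
move=> e; apply: groth_ext => [u v|u v|x].
- exact: burnside_resD.
- by rewrite (burnside_resD f') (burnside_resD f).
rewrite (burnside_res_cl f') !burnside_res_cl (cls_repr x) !gclass_resE.
congr gcl; apply/clsP.
by exists id; split=> [|k y]; [exists id | rewrite /= e].
Qed.

Section Out.
Variable G : finGroupType.
Implicit Types a b : {perm G}.

Definition inn : {group {perm G}} := (conj_aut [set: G] @* [set: G])%G.

(* Permutations compose from left to right in the library, (s * t) x = t (s x),
   so that the product x * y in Out is the class of the composite "x, then y":
   the group law given by composition of automorphisms is (x, y) |-> y * x. *)
Definition Out := [subg (Aut [set: G] / inn)%g].
HB.instance Definition _ := FinGroup.on Out.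

Definition out_rep (x : Out) : {perm G} := fingroup.repr (sgval x).

Fact out_rep_norm (x : Out) : out_rep x \in 'N(inn)%g.
Proof. exact: repr_coset_norm. Qed.

Fact coset_out_rep (x : Out) : coset inn (out_rep x) = sgval x.
Proof. exact: coset_reprK. Qed.

Fact out_repP (x : Out) : out_rep x \in Aut [set: G].
Proof.
have /morphimP[a Na Aa e] := subgP x.
have [|i Ii ->] := kercoset_rcoset (out_rep_norm x) Na.
  exact: etrans (coset_out_rep x) e.
by rewrite groupM// (subsetP (Aut_conj_aut _ _) _ Ii).
Qed.

Definition out_morphism (x : Out) : {morphism [set: G] >-> G} :=
  autm_morphism (out_repP x).

Lemma coset_innP a b : a \in 'N(inn)%g -> b \in 'N(inn)%g ->
    b \in Aut [set: G] -> coset inn a = coset inn b ->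
  exists c : G, forall x, (a x = b x ^ c)%g.
Proof.
move=> Na Nb Ab /(kercoset_rcoset Na Nb)[_ /morphimP[g Ng _ ->] ->].
exists (b g) => x; rewrite permM conj_autE ?inE//.
by rewrite -!(autmE Ab) morphJ ?inE.
Qed.

Lemma out_morphismM (x y : Out) : exists c : G, forall g,
  (out_morphism (x * y)%g g = out_morphism y (out_morphism x g) ^ c)%g.
Proof.
have [||||c cE] := @coset_innP (out_rep (x * y)%g) (out_rep x * out_rep y)%g.
- exact: out_rep_norm.
- by rewrite groupM ?out_rep_norm.
- by rewrite groupM ?out_repP.
- have e z : coset_morphism inn (out_rep z) = sgval z := coset_out_rep z.
  by rewrite morphM ?out_rep_norm// !e sgvalM ?inE.
by exists c => g; rewrite /= !autmE cE permM.
Qed.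

(* The class of an automorphism phi acts by transport of structure: g acts on
   the G-set ^phi X as phi^-1 g acts on X. *)
Definition out_act (x : Out) (u : burnside G) : burnside G :=
  burnside_res (out_morphism x^-1%g) u.

Lemma out_actD x : {morph out_act x : u v / u + v}.
Proof. exact: burnside_resD. Qed.
Lemma out_actM x : {morph out_act x : u v / u * v}.
Proof. exact: burnside_resM. Qed.
Lemma out_act1 x : out_act x 1 = 1.
Proof. exact: burnside_res1. Qed.

Lemma out_act_comp (x y : Out) u :
  out_act (y * x)%g u = out_act x (out_act y u).
Proof.
have [c cE] := out_morphismM x^-1%g y^-1%g.
pose f : G -> G := out_morphism y^-1%g \o out_morphism x^-1%g.
have fM : {in [set: G] &, {morph f : k l / (k * l)%g}}.
  by move=> k l _ _; rewrite /f /= !morphM ?inE.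
rewrite /out_act invMg -(@eq_burnside_res _ _ (Morphism fM) _ c cE).
exact: burnside_res_comp.
Qed.

Lemma out_act_one u : out_act 1%g u = u.
Proof.
have idM : {in [set: G] &, {morph id : k l / (k * l)%g}} by [].
have [|c cE] := @coset_innP (out_rep 1%g) 1%g (out_rep_norm _) (group1 _)
    (group1 _).
  by rewrite coset_out_rep coset_id ?group1.
rewrite /out_act invg1 -(@eq_burnside_res _ _ (Morphism idM) _ c); last first.
  by move=> k; rewrite /= autmE cE perm1.
move: u; apply: groth_ext => [u v|u v|x] //; first exact: burnside_resD.
rewrite burnside_res_cl (cls_repr x) gclass_resE; congr gcl; apply/clsP.
by exists id; split=> //; exists id.
Qed.

Lemma Aut_norm_inn : Aut [set: G] \subset 'N(inn)%g.
Proof.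
apply/subsetP => a Aa; rewrite inE; apply/subsetP => _ /imsetP[i Ii ->].
have /morphimP[g Ng _ ->] := Ii.
suff -> : (conj_aut [set: G] g ^ a = conj_aut [set: G] (a g))%g.
  by apply: mem_morphim; rewrite ?(subsetP (normG _)) ?in_setT.
apply/permP => x; rewrite conjgE !permM !conj_autE ?inE//.
by rewrite -(autmE Aa) morphJ ?inE//= autmE permKV.
Qed.

Lemma out_act_coset (x : Out) (a : {perm G}) (R : {group G}) :
    a \in Aut [set: G] -> sgval x = coset inn a ->
  out_act x (coset_elt R) = coset_elt (a @: R).
Proof.
move=> Aa xa; have Na := subsetP Aut_norm_inn a Aa.
have AaV : a^-1%g \in Aut [set: G] by rewrite groupV.
have [c cE] : exists c, forall g, (out_rep x^-1 g = a^-1%g g ^ c)%g.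
  apply: coset_innP; rewrite ?groupV ?out_rep_norm//.
  rewrite coset_out_rep (morphV (coset_morphism inn) Na) -[_ a]xa.
  by [].
rewrite /out_act -(@eq_burnside_res _ _ (autm_morphism AaV) _ c); last first.
  by move=> g; rewrite /= !autmE cE.
rewrite burnside_res_cl gclass_resE; congr gcl.
have -> : a @: R = (autm_morphism Aa @* R)%G.
  by rewrite /= morphimE setTI.
have LR : (1 *: R)%g \in lcosets R [set: G].
  by apply/lcosetsP; exists 1%g; rewrite ?inE.
apply: (@cls_coset _ _ _ _ (Sub (1 *: R)%g LR)).
  case=> A iA; have /lcosetsP[g _ e] := iA; exists (a g).
  apply: val_inj; rewrite /= autmE permK e.
  by rewrite lcoset1.
move=> g; rewrite -[g in g \in _](permKV a).
have -> : (a (a^-1%g g) \in (autm_morphism Aa @* R)%G) = (a^-1%g g \in R).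
  rewrite /= morphimE setTI; exact: mem_imset (@perm_inj _ a).
split=> [/(congr1 val)|gR]; last apply: val_inj => /=;
  rewrite /= autmE lcoset1.
  by move=> e; have := lcoset_refl R (a^-1%g g); rewrite e.
by rewrite lcoset_id.
Qed.

Lemma out_act_unit x (u : burnside G) :
  u \is a GRing.unit -> out_act x u \is a GRing.unit.
Proof.
move=> uU; apply/unitrPr; exists (out_act x u^-1).
by rewrite -out_actM mulrV// out_act1.
Qed.

Definition out_act_u (x : Out) (u : unit_group (burnside G)) :
  unit_group (burnside G) := Sub (out_act x (val u)) (out_act_unit x (valP u)).

Lemma out_act_uM x : {morph out_act_u x : u v / (u * v)%g}.
Proof. by move=> u v; apply: val_inj; rewrite /= out_actM. Qed.
Lemma out_act_u_comp (x y : Out) u :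
  out_act_u (y * x)%g u = out_act_u x (out_act_u y u).
Proof. by apply: val_inj; rewrite /= out_act_comp. Qed.
Lemma out_act_u_one u : out_act_u 1%g u = u.
Proof. by apply: val_inj; rewrite /= out_act_one. Qed.
Lemma out_act_u1 x : out_act_u x 1%g = 1%g.
Proof. by apply: val_inj; rewrite /= out_act1. Qed.

Definition burnside_sdprod : Type := (unit_group (burnside G) * Out)%type.
HB.instance Definition _ := Choice.on burnside_sdprod.

Definition sd_mul (p q : burnside_sdprod) : burnside_sdprod :=
  ((p.1 * out_act_u p.2 q.1)%g, (q.2 * p.2)%g).
Definition sd_one : burnside_sdprod := (1%g, 1%g).
Definition sd_inv (p : burnside_sdprod) : burnside_sdprod :=
  (out_act_u p.2^-1%g p.1^-1%g, p.2^-1%g).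

Fact sd_mulA : associative sd_mul.
Proof.
by move=> p q r; rewrite /sd_mul /= out_act_uM out_act_u_comp !mulgA.
Qed.
Fact sd_mul1 : left_id sd_one sd_mul.
Proof.
by case=> u x; rewrite /sd_mul /= out_act_u_one mul1g mulg1.
Qed.
Fact sd_mulr1 : right_id sd_one sd_mul.
Proof. by case=> u x; rewrite /sd_mul /= out_act_u1 mul1g mulg1. Qed.
Fact sd_mulV : left_inverse sd_one sd_inv sd_mul.
Proof.
by case=> u x; rewrite /sd_mul /= -out_act_uM mulVg mulgV out_act_u1.
Qed.
Fact sd_mulrV : right_inverse sd_one sd_inv sd_mul.
Proof.
case=> u x; rewrite /sd_mul /= -out_act_u_comp mulVg out_act_u_one mulgV.
by [].
Qed.
HB.instance Definition _ := isGroup.Build burnside_sdprod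
  sd_mulA sd_mul1 sd_mulr1 sd_mulV sd_mulrV.

End Out.

(* A (G, H)-biset is a left (G * H)-set, with (g, h) x = g x h^-1. *)
Section BisetActions.
Variables (G H : finGroupType) (T : Type) (a : lact (G * H)%type T).

Definition lmul (g : G) (x : T) : T := a (g, 1%g) x.
Definition rmul (x : T) (h : H) : T := a (1%g, h^-1%g) x.

Definition bifree : Prop :=
  (forall g x, lmul g x = x -> g = 1%g) /\ (forall x h, rmul x h = x -> h = 1%g).

Lemma lmul1 x : lmul 1%g x = x.
Proof. exact: lact1. Qed.
Lemma rmul1 x : rmul x 1%g = x.
Proof. by rewrite /rmul invg1; apply: lact1. Qed.
Lemma lmulM g g' x : lmul (g * g')%g x = lmul g (lmul g' x).
Proof. by rewrite /lmul -lactM; congr (a (_, _) x); rewrite mulg1. Qed.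
Lemma rmulM h h' x : rmul x (h * h')%g = rmul (rmul x h) h'.
Proof.
by rewrite /rmul -lactM; congr (a (_, _) x); rewrite ?mulg1 ?invMg.
Qed.
Lemma lrmulC g h x : lmul g (rmul x h) = rmul (lmul g x) h.
Proof.
by rewrite /rmul /lmul -!lactM; congr (a (_, _) x); rewrite !(mulg1, mul1g).
Qed.
Lemma bimulE gh x : a gh x = rmul (lmul gh.1 x) gh.2^-1%g.
Proof.
case: gh => g h; rewrite /rmul /lmul -lactM invgK.
by congr (a (_, _) x); rewrite ?mulg1 ?mul1g.
Qed.
End BisetActions.

Lemma bifree_iso (G H : finGroupType) T U (a : lact (G * H)%type T)
    (b : lact (G * H)%type U) :
  lact_iso a b -> bifree a -> bifree b.
Proof.
move=> [f [[f' fK f'K] fE]] [al ar]; split=> [g y e|y h e].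
  by apply: (al g (f' y)); apply: (can_inj fK); rewrite fE f'K.
by apply: (ar (f' y) h); apply: (can_inj fK); rewrite fE f'K.
Qed.

Definition biburnside (G H : finGroupType) := groth (gclass (G * H)%type).
HB.instance Definition _ G H := GRing.Zmodule.on (biburnside G H).

Section Bifree.
Variables G H : finGroupType.

(* B^Delta(G, H), the subgroup of B(G, H) of differences of classes of bifree
   bisets. *)
Definition Bdelta : {pred biburnside G H} := fun gamma =>
  `[< exists (T U : finType) (a : lact (G * H)%type T)
        (b : lact (G * H)%type U),
      [/\ bifree a, bifree b & gamma = gcl (cls a) - gcl (cls b)] >].

Lemma BdeltaP (gamma : biburnside G H) :
  reflect (exists (T U : finType) (a : lact (G * H)%type T)
             (b : lact (G * H)%type U),
           [/\ bifree a, bifree b & gamma = gcl (cls a) - gcl (cls b)])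
    (gamma \in Bdelta).
Proof. exact: asboolP. Qed.

Lemma bifree_sum T U (a : lact (G * H)%type T) (b : lact (G * H)%type U) :
  bifree a -> bifree b -> bifree (sum_lact a b).
Proof.
move=> [al ar] [bl br].
by split=> [g [] x [e]|[] x h [e]]; [apply: al e|apply: bl e|apply: ar e|apply: br e].
Qed.

Lemma Bdelta_cls (T : finType) (a : lact (G * H)%type T) :
  bifree a -> (gcl (cls a) : biburnside G H) \in Bdelta.
Proof.
move=> af; apply/BdeltaP; exists T, void, a, (triv_lact _ void).
by split=> //; apply/esym; apply: subr0.
Qed.

Fact Bdelta_zmod_closed : zmod_closed Bdelta.
Proof.
split=> [|u v /BdeltaP[T [U [a [b [af bf ->]]]]] /BdeltaP[T' [U' [a' [b' [af' bf' ->]]]]]].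
  have vf : bifree (triv_lact (G * H)%type void) by split=> [g []|[]].
  apply/BdeltaP; exists void, void, (triv_lact _ void), (triv_lact _ void).
  by rewrite subrr.
apply/BdeltaP; exists _, _, (sum_lact a b'), (sum_lact b a').
split; try exact: bifree_sum.
by rewrite !clsD !gclD !opprD opprK (AC (2*2) ((1*4)*(2*3))).
Qed.
HB.instance Definition _ :=
  GRing.isZmodClosed.Build (biburnside G H) Bdelta Bdelta_zmod_closed.
End Bifree.
Arguments Bdelta : clear implicits.

Section Tensor.
Variables (G H K : finGroupType).

Section Def.
Variables (T U : finType) (a : lact (G * H)%type T) (b : lact (H * K)%type U).

Definition mid_act (h : H) (p : T * U) : T * U :=
  (rmul a p.1 h^-1%g, lmul b h p.2).
Definition mid_orbit (p : T * U) : {set T * U} := [set mid_act h p | h : H].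

Definition tensor := {A : {set T * U} | [exists p, A == mid_orbit p]}.
HB.instance Definition _ := Finite.on tensor.

Fact tens_subproof p : [exists q, mid_orbit p == mid_orbit q].
Proof. by apply/existsP; exists p. Qed.
Definition tens (x : T) (y : U) : tensor :=
  Sub (mid_orbit (x, y)) (tens_subproof (x, y)).

Definition outer_act (gk : G * K) (p : T * U) : T * U :=
  (lmul a gk.1 p.1, rmul b p.2 gk.2^-1%g).

Lemma outer_orbit gk p :
  [set outer_act gk q | q in mid_orbit p] = mid_orbit (outer_act gk p).
Proof.
rewrite /mid_orbit -imset_comp; apply: eq_imset => h.
by rewrite /= /outer_act /mid_act /= !lrmulC.
Qed.

Fact tensor_fun_subproof (gk : G * K) (A : tensor) :
  [exists p, [set outer_act gk q | q in val A] == mid_orbit p].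
Proof.
have /existsP[p /eqP->] := valP A.
by apply/existsP; exists (outer_act gk p); rewrite outer_orbit.
Qed.
Definition tensor_fun (gk : G * K) (A : tensor) : tensor :=
  Sub [set outer_act gk q | q in val A] (tensor_fun_subproof gk A).

Lemma tensor_funE gk x y :
  tensor_fun gk (tens x y) = tens (lmul a gk.1 x) (rmul b y gk.2^-1%g).
Proof. by apply: val_inj; rewrite /= outer_orbit. Qed.

Lemma tensorP (A : tensor) : exists x y, A = tens x y.
Proof.
have /existsP[[x y] /eqP e] := valP A.
by exists x, y; apply: val_inj.
Qed.

Fact tensor_is_lact : is_lact tensor_fun.
Proof.
split=> [A|[g k] [g' k'] A]; have [x [y ->]] := tensorP A.
  by rewrite tensor_funE /= lmul1 invg1 rmul1.
by rewrite !tensor_funE /= lmulM invMg rmulM.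
Qed.
Definition tensor_lact := Lact tensor_is_lact.

Lemma tens_eq x y x' y' : tens x y = tens x' y' <->
  exists h, x = rmul a x' h^-1%g /\ y = lmul b h y'.
Proof.
split=> [/(congr1 val) /= e|[h [-> ->]]].
  have : (x, y) \in mid_orbit (x, y).
    by apply/imsetP; exists 1%g; rewrite // /mid_act /= invg1 rmul1 lmul1.
  by rewrite e => /imsetP[h _ [-> ->]]; exists h.
apply: val_inj => /=; apply/setP => p; apply/imsetP/imsetP => -[k _ ->].
  by exists (k * h)%g; rewrite // /mid_act /= invMg rmulM lmulM.
exists (k * h^-1)%g; rewrite // /mid_act /= invMg invgK -rmulM -lmulM mulgA.
by rewrite mulVg mul1g mulgKV.
Qed.

Lemma tens_balanced x h y : tens (rmul a x h) y = tens x (lmul b h y).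
Proof.
apply/tens_eq; exists h^-1%g; rewrite invgK; split=> //.
by rewrite -lmulM mulVg lmul1.
Qed.

Lemma tensor_iso (V : finType) (c : lact (G * K)%type V) (q : T -> U -> V) :
  (forall z, exists x y, z = q x y) ->
  (forall x y x' y', q x y = q x' y' <-> tens x y = tens x' y') ->
  (forall g k x y, q (lmul a g x) (rmul b y k^-1%g) = c (g, k) (q x y)) ->
  lact_iso tensor_lact c.
Proof.
move=> qs qi qE.
have ex (A : tensor) : exists p : T * U, A == tens p.1 p.2.
  by have [x [y ->]] := tensorP A; exists (x, y).
pose f A := let p := xchoose (ex A) in q p.1 p.2.
have fE x y : f (tens x y) = q x y.
  by apply/qi; rewrite -(eqP (xchooseP (ex (tens x y)))).
apply: (@lact_isoP _ _ _ _ _ f).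
- move=> A B; have [x [y ->]] := tensorP A; have [x' [y' ->]] := tensorP B.
  by rewrite !fE => /qi.
- by move=> z; have [x [y ->]] := qs z; exists (tens x y).
move=> [g k] A; have [x [y ->]] := tensorP A.
by rewrite /= tensor_funE !fE qE.
Qed.
End Def.

Lemma tensor_bifree (T U : finType) (a : lact (G * H)%type T)
    (b : lact (H * K)%type U) :
  bifree a -> bifree b -> bifree (tensor_lact a b).
Proof.
move=> [al ar] [bl br]; split=> [g A|A k]; have [x [y ->]] := tensorP A.
  rewrite /lmul /= tensor_funE /= invg1 rmul1 => /tens_eq[h [ex ey]].
  by move: ex; rewrite (bl h y)// invg1 rmul1 => /al.
rewrite /rmul /= tensor_funE /= invgK lmul1 => /tens_eq[h [ex ey]].
have h1 : h = 1%g by apply/eqP; rewrite -invg_eq1; apply/eqP/(ar x).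
by move: ey; rewrite h1 lmul1 => /br.
Qed.

Lemma tensor_lact_iso (T U T' U' : finType) (a : lact (G * H)%type T)
    (b : lact (H * K)%type U) (a' : lact (G * H)%type T')
    (b' : lact (H * K)%type U') :
  lact_iso a a' -> lact_iso b b' ->
  lact_iso (tensor_lact a b) (tensor_lact a' b').
Proof.
move=> [f [[f' fK f'K] fE]] [t [[t' tK t'K] tE]].
apply: (tensor_iso (q := fun x y => tens a' b' (f x) (t y))) => [A|x y x' y'|].
- have [x [y ->]] := tensorP A.
  by exists (f' x), (t' y); rewrite f'K t'K.
- split=> /tens_eq[h [ex ey]]; apply/tens_eq; exists h.
    split; [apply: (can_inj fK) | apply: (can_inj tK)].
      by rewrite ex /rmul fE.
    by rewrite ey /lmul tE.
  by rewrite ex ey /rmul /lmul fE tE.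
by move=> g k x y; rewrite /= tensor_funE /= {1}/lmul {1}/rmul fE tE.
Qed.

Definition gclass_tens (x : gclass (G * H)%type) (y : gclass (H * K)%type) :
  gclass (G * K)%type := cls (tensor_lact (gact (repr x)) (gact (repr y))).

Lemma gclass_tensE (T U : finType) (a : lact (G * H)%type T)
    (b : lact (H * K)%type U) :
  gclass_tens (cls a) (cls b) = cls (tensor_lact a b).
Proof. by apply/clsP/tensor_lact_iso; apply: cls_gact. Qed.

Lemma tensor_sum_l (T T' U : finType) (a : lact (G * H)%type T)
    (a' : lact (G * H)%type T') (b : lact (H * K)%type U) :
  lact_iso (tensor_lact (sum_lact a a') b)
    (sum_lact (tensor_lact a b) (tensor_lact a' b)).
Proof.
pose q (s : T + T') (z : U) : tensor a b + tensor a' b :=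
  match s with inl u => inl (tens a b u z) | inr u => inr (tens a' b u z) end.
apply: (@tensor_iso _ _ _ _ _ _ q).
- case=> A; have [u [z ->]] := tensorP A.
    by exists (inl u), z.
  by exists (inr u), z.
- move=> [u|u] z [v|v] z'; split=> [[]|/tens_eq[h []]] //=.
  + move=> e; have /tens_eq[h [-> ->]] : tens a b u z = tens a b v z'.
      exact: val_inj.
    by apply/tens_eq; exists h.
  + by case=> -> ->; congr inl; apply/tens_eq; exists h.
  + move=> e; have /tens_eq[h [-> ->]] : tens a' b u z = tens a' b v z'.
      exact: val_inj.
    by apply/tens_eq; exists h.
  by case=> -> ->; congr inr; apply/tens_eq; exists h.
by move=> g k [] u z /=; rewrite tensor_funE.
Qed.

Lemma tensor_sum_r (T U U' : finType) (a : lact (G * H)%type T)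
    (b : lact (H * K)%type U) (b' : lact (H * K)%type U') :
  lact_iso (tensor_lact a (sum_lact b b'))
    (sum_lact (tensor_lact a b) (tensor_lact a b')).
Proof.
pose q (z : T) (s : U + U') : tensor a b + tensor a b' :=
  match s with inl u => inl (tens a b z u) | inr u => inr (tens a b' z u) end.
apply: (@tensor_iso _ _ _ _ _ _ q).
- case=> A; have [u [z ->]] := tensorP A.
    by exists u, (inl z).
  by exists u, (inr z).
- move=> z [u|u] z' [v|v]; split=> [[]|/tens_eq[h []]] //=.
  + move=> e; have /tens_eq[h [-> ->]] : tens a b z u = tens a b z' v.
      exact: val_inj.
    by apply/tens_eq; exists h.
  + by move=> ->; case=> ->; congr inl; apply/tens_eq; exists h.
  + move=> e; have /tens_eq[h [-> ->]] : tens a b' z u = tens a b' z' v.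
      exact: val_inj.
    by apply/tens_eq; exists h.
  by move=> ->; case=> ->; congr inr; apply/tens_eq; exists h.
by move=> g k u [] z /=; rewrite tensor_funE.
Qed.

Fact gclass_tensDl y : {morph gclass_tens^~ y : x x' / x + x'}.
Proof.
move=> x x'; rewrite (cls_repr x) (cls_repr x') (cls_repr y) -clsD.
by rewrite !gclass_tensE -clsD; apply/clsP/tensor_sum_l.
Qed.

Fact gclass_tensDr x : {morph gclass_tens x : y y' / y + y'}.
Proof.
move=> y y'; rewrite (cls_repr x) (cls_repr y') (cls_repr y) -clsD.
by rewrite !gclass_tensE -clsD; apply/clsP/tensor_sum_r.
Qed.

Fact gcl_tensDl y : {morph (fun x => gcl (gclass_tens x y)) : x x' / x + x'}.
Proof. by move=> x x'; rewrite gclass_tensDl gclD. Qed.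
Fact gcl_tensDr x : {morph (fun y => gcl (gclass_tens x y)) : y y' / y + y'}.
Proof. by move=> y y'; rewrite gclass_tensDr gclD. Qed.

Definition bmul : biburnside G H -> biburnside H K -> biburnside G K :=
  gext2 (fun x y => gcl (gclass_tens x y)).

Lemma bmul_cl (T U : finType) (a : lact (G * H)%type T)
    (b : lact (H * K)%type U) :
  bmul (gcl (cls a)) (gcl (cls b)) = gcl (cls (tensor_lact a b)).
Proof.
by rewrite -gclass_tensE; apply: gext2_cl; [apply: gcl_tensDl|apply: gcl_tensDr].
Qed.
Lemma bmulDl v : {morph bmul^~ v : u u' / u + u'}.
Proof. exact: gext2Dl gcl_tensDl v. Qed.
Lemma bmulDr u : {morph bmul u : v v' / v + v'}.
Proof. exact: gext2Dr gcl_tensDr u. Qed.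
Lemma bmulNl v : {morph bmul^~ v : u / - u}.
Proof. exact: morphN (bmulDl v). Qed.
Lemma bmulNr u : {morph bmul u : v / - v}.
Proof. exact: morphN (bmulDr u). Qed.

Lemma bmul_Bdelta u v :
  u \in Bdelta G H -> v \in Bdelta H K -> bmul u v \in Bdelta G K.
Proof.
move=> /BdeltaP[T [T' [a [a' [af af' ->]]]]] /BdeltaP[U [U' [b [b' [bf bf' ->]]]]].
rewrite bmulDl bmulNl !bmulDr !bmulNr !bmul_cl.
by rewrite !(rpredD, rpredN)// Bdelta_cls//; apply: tensor_bifree.
Qed.
End Tensor.

Section Identity.
Variable G : finGroupType.

Fact id_is_lact :
  is_lact (fun (gh : G * G) (x : G) => gh.1 * x * gh.2^-1)%g.
Proof.
split=> [x|[g g'] [h h'] x] /=; first by rewrite mul1g invg1 mulg1.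
by rewrite invMg !mulgA.
Qed.
Definition id_lact : lact (G * G)%type G := Lact id_is_lact.

Lemma id_bifree : bifree id_lact.
Proof.
split=> [g x|x h]; rewrite /lmul /rmul /=.
  by rewrite invg1 mulg1 -[RHS]mul1g => /mulIg.
by rewrite invgK mul1g -[RHS]mulg1 => /mulgI.
Qed.

(* The element [G], i.e. G with left and right multiplication. *)
Definition bid : biburnside G G := gcl (cls id_lact).

Lemma bid_Bdelta : bid \in Bdelta G G.
Proof. exact: Bdelta_cls id_bifree. Qed.
End Identity.

Section BmulTheory.
Variables G H K F : finGroupType.

Lemma bmul1 (u : biburnside G H) : bmul (bid G) u = u.
Proof.
move: u; apply: groth_ext => [u v|u v|x] //; first exact: bmulDr.
rewrite (cls_repr x) bmul_cl; congr gcl; apply/clsP.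
move: (gact _) => a; pose q (g : G) x := lmul a g x.
apply: (@tensor_iso _ _ _ _ _ _ _ _ _ q).
- by move=> z; exists 1%g, z; rewrite /q lmul1.
- move=> g z g' z'; rewrite tens_eq /q /rmul /=; split=> [e|[h [-> ->]]].
    exists (g^-1 * g')%g; rewrite !invgK mul1g invMg invgK mulKVg.
    by rewrite lmulM -e -lmulM mulVg lmul1.
  by rewrite !invgK mul1g -lmulM mulgKV.
move=> g k h z; rewrite /q bimulE.
have -> : lmul (id_lact G) g h = (g * h)%g by rewrite /lmul /= invg1 mulg1.
by rewrite lmulM !lrmulC.
Qed.

Lemma bmulr1 (u : biburnside G H) : bmul u (bid H) = u.
Proof.
move: u; apply: groth_ext => [u v|u v|x] //; first exact: bmulDl.
rewrite (cls_repr x) bmul_cl; congr gcl; apply/clsP.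
move: (gact _) => a; pose q x (h : H) := rmul a x h.
apply: (@tensor_iso _ _ _ _ _ _ _ _ _ q).
- by move=> z; exists z, 1%g; rewrite /q rmul1.
- move=> z g z' g'; rewrite tens_eq /q /lmul /=; split=> [e|[h [-> ->]]].
    exists (g * g'^-1)%g; rewrite invg1 mulg1 invMg invgK mulgKV.
    by rewrite rmulM -e -rmulM mulgV rmul1.
  by rewrite invg1 mulg1 -rmulM mulKg.
move=> g k z h; rewrite /q bimulE.
have -> : rmul (id_lact H) h k^-1 = (h * k^-1)%g by rewrite /rmul /= invgK mul1g.
by rewrite rmulM !lrmulC.
Qed.
End BmulTheory.

Section TensorAssoc.
Variables (G H K F : finGroupType) (T U V : finType).
Variables (a : lact (G * H)%type T) (b : lact (H * K)%type U).
Variable c : lact (K * F)%type V.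

Lemma lmul_tens g x y :
  lmul (tensor_lact a b) g (tens a b x y) = tens a b (lmul a g x) y.
Proof. by rewrite /lmul /= tensor_funE /= invg1 rmul1. Qed.
Lemma rmul_tens x y k :
  rmul (tensor_lact a b) (tens a b x y) k = tens a b x (rmul b y k).
Proof. by rewrite /rmul /= tensor_funE /= invgK lmul1. Qed.

End TensorAssoc.

Lemma tensorA (G H K F : finGroupType) (T U V : finType)
    (a : lact (G * H)%type T) (b : lact (H * K)%type U)
    (c : lact (K * F)%type V) :
  lact_iso (tensor_lact (tensor_lact a b) c) (tensor_lact a (tensor_lact b c)).
Proof.
have ex (A : tensor a b) : exists p : T * U, A == tens a b p.1 p.2.
  by have [x [y ->]] := tensorP A; exists (x, y).
pose q A z := let p := xchoose (ex A) in
  tens a (tensor_lact b c) p.1 (tens b c p.2 z).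
have qE x y z : q (tens a b x y) z = tens a (tensor_lact b c) x (tens b c y z).
  have := xchooseP (ex (tens a b x y)); rewrite /q.
  move: (xchoose _) => [x' y'] /= /eqP/tens_eq[h [-> ->]].
  by rewrite tens_balanced lmul_tens -lmulM mulVg lmul1.
apply: (@tensor_iso _ _ _ _ _ _ _ _ _ q).
- move=> A; have [x [B ->]] := tensorP A; have [y [z ->]] := tensorP B.
  by exists (tens a b x y), z.
- move=> A z A' z'.
  have [x [y ->]] := tensorP A; have [x' [y' ->]] := tensorP A'.
  rewrite !qE !tens_eq; split=> -[h].
    rewrite lmul_tens => -[-> /tens_eq[k [-> ->]]]; exists k.
    rewrite rmul_tens; split=> //; apply/tens_eq; exists h.
    by rewrite lrmulC.
  rewrite rmul_tens => -[/tens_eq[k [-> ->]] ->]; exists k; split=> //.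
  by rewrite lmul_tens; apply/tens_eq; exists h; rewrite lrmulC.
move=> g k A z; have [x [y ->]] := tensorP A.
by rewrite lmul_tens !qE [RHS]tensor_funE rmul_tens.
Qed.

Lemma bmulA (G H K F : finGroupType) (u : biburnside G H)
    (v : biburnside H K) (w : biburnside K F) :
  bmul u (bmul v w) = bmul (bmul u v) w.
Proof.
move: u; apply: groth_ext => [x y|x y|x].
- exact: bmulDl.
- by rewrite (bmulDl v) bmulDl.
move: v; apply: groth_ext => [y z|y z|y].
- by rewrite bmulDl bmulDr.
- by rewrite bmulDr bmulDl.
move: w; apply: groth_ext => [z t|z t|z].
- by rewrite (bmulDr (gcl y)) bmulDr.
- exact: bmulDr.
rewrite (cls_repr x) (cls_repr y) (cls_repr z) !bmul_cl; congr gcl.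
by apply/esym/clsP/tensorA.
Qed.

Section Opposite.
Variables G H : finGroupType.

Definition swap (p : H * G) : G * H := (p.2, p.1).
Fact swapM : {in [set: H * G] &, {morph swap : x y / (x * y)%g}}.
Proof. by []. Qed.
Canonical swap_morphism := Morphism swapM.

Definition bop : biburnside G H -> biburnside H G :=
  burnside_res swap_morphism.

Lemma bopD : {morph bop : u v / u + v}.
Proof. exact: burnside_resD. Qed.
Lemma bopN : {morph bop : u / - u}.
Proof. exact: morphN bopD. Qed.
Lemma bop_cl (T : finType) (a : lact (G * H)%type T) :
  bop (gcl (cls a)) = gcl (cls (res_lact swap_morphism a)).
Proof. by rewrite /bop burnside_res_cl gclass_resE. Qed.

(* The element [(G x H)/L]. *)
Definition bcoset (L : {set G * H}) : biburnside G H := coset_elt L.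

End Opposite.

Lemma bop_bcoset (G H : finGroupType) (L : {group G * H}) :
  bop (bcoset L) = bcoset [set (p.2, p.1) | p in L].
Proof.
rewrite /bop /bcoset /coset_elt burnside_res_cl gclass_resE; congr gcl.
have -> : [set (p.2, p.1) | p in L] = (swap_morphism H G @* L)%G.
  by rewrite /= morphimE setTI.
have LL : (1 *: L)%g \in lcosets L [set: G * H].
  by apply/lcosetsP; exists 1%g; rewrite ?inE.
apply: (@cls_coset _ _ _ _ (Sub (1 *: L)%g LL)).
  case=> A iA; have /lcosetsP[[g h] _ e] := iA; exists (h, g).
  by apply: val_inj; rewrite /= e lcoset1.
move=> [h g].
have -> : ((h, g) \in (swap_morphism H G @* L)%G) = ((g, h) \in L).
  rewrite /= morphimE setTI; apply: (mem_imset _ (g, h)).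
  by move=> [? ?] [? ?] [-> ->].
split=> [/(congr1 val)|gR]; last apply: val_inj; rewrite /= lcoset1.
  by move=> e; have := lcoset_refl L (g, h); rewrite e.
by rewrite lcoset_id.
Qed.

Lemma bopK (G H : finGroupType) : cancel (@bop G H) (@bop H G).
Proof.
apply: groth_ext => [u v|u v|x] //; first by rewrite (@bopD G H) bopD.
rewrite (cls_repr x) !bop_cl; congr gcl; apply/clsP.
by exists id; split; [exists id | case].
Qed.

Lemma bop_Bdelta (G H : finGroupType) u :
  u \in Bdelta G H -> bop u \in Bdelta H G.
Proof.
move=> /BdeltaP[T [U [a [b [[al ar] [bl br] ->]]]]].
rewrite bopD bopN !bop_cl; apply/BdeltaP.
exists T, U, (res_lact (swap_morphism G H) a), (res_lact (swap_morphism G H) b).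
split=> //; split=> [h x e|x g e].
- by apply/eqP; rewrite -invg_eq1; apply/eqP/(ar x); rewrite /rmul invgK.
- by apply/eqP; rewrite -invg_eq1; apply/eqP/(al _ x).
- by apply/eqP; rewrite -invg_eq1; apply/eqP/(br x); rewrite /rmul invgK.
by apply/eqP; rewrite -invg_eq1; apply/eqP/(bl _ x).
Qed.

Lemma bopM (G H K : finGroupType) (u : biburnside G H) (v : biburnside H K) :
  bop (bmul u v) = bmul (bop v) (bop u).
Proof.
move: u; apply: groth_ext => [x y|x y|x].
- by rewrite bmulDl bopD.
- by rewrite bopD bmulDr.
move: v; apply: groth_ext => [z y|z y|y].
- by rewrite bmulDr bopD.
- by rewrite bopD bmulDl.
rewrite (cls_repr x) (cls_repr y).
rewrite bmul_cl !bop_cl bmul_cl; congr gcl; apply/esym/clsP.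
move: (gact _) (gact _) => a b; pose q z t := tens a b t z.
apply: (@tensor_iso _ _ _ _ _ _ _ _ _ q).
- by move=> A; have [t [z ->]] := tensorP A; exists z, t.
- move=> z t z' t'; rewrite /q !tens_eq /rmul /lmul /=.
  by split=> -[h [-> ->]]; exists h; rewrite ?invgK.
by move=> g k z t; rewrite /q /= tensor_funE /rmul /lmul /= ?invgK.
Qed.

Lemma bop1 (G : finGroupType) : bop (bid G) = bid G.
Proof.
rewrite bop_cl; congr gcl; apply/clsP.
exists (@invg G); split; first by exists (@invg G); apply: invgK.
by move=> [g h] x; rewrite /= !invMg invgK mulgA.
Qed.

Definition Borth (G H : finGroupType) : {pred biburnside G H} := fun gamma =>
  [&& gamma \in Bdelta G H, bmul gamma (bop gamma) == bid G
    & bmul (bop gamma) gamma == bid H].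
Arguments Borth : clear implicits.

Section OrthGroup.
Variable G : finGroupType.

Definition orth_group := {gamma : biburnside G G | gamma \in Borth G G}.
HB.instance Definition _ := Choice.on orth_group.

Fact orth_one_subproof : bid G \in Borth G G.
Proof. by apply/and3P; rewrite bop1 bmul1 bid_Bdelta. Qed.
Fact orth_inv_subproof (u : orth_group) : bop (val u) \in Borth G G.
Proof.
have /and3P[ud ul ur] := valP u.
by apply/and3P; rewrite bopK bop_Bdelta.
Qed.
Fact orth_mul_subproof (u v : orth_group) : bmul (val u) (val v) \in Borth G G.
Proof.
have /and3P[ud /eqP ul /eqP ur] := valP u.
have /and3P[vd /eqP vl /eqP vr] := valP v.
apply/and3P; split; first exact: bmul_Bdelta.
  by rewrite bopM -bmulA [X in bmul _ X]bmulA vl bmul1 ul.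
by rewrite bopM -bmulA [X in bmul _ X]bmulA ur bmul1 vr.
Qed.
Definition orth_one : orth_group := Sub (bid G) orth_one_subproof.
Definition orth_inv u : orth_group := Sub (bop (val u)) (orth_inv_subproof u).
Definition orth_mul u v : orth_group :=
  Sub (bmul (val u) (val v)) (orth_mul_subproof u v).

Fact orth_mulA : associative orth_mul.
Proof. by move=> u v w; apply: val_inj; rewrite /= bmulA. Qed.
Fact orth_mul1 : left_id orth_one orth_mul.
Proof. by move=> u; apply: val_inj; rewrite /= bmul1. Qed.
Fact orth_mulr1 : right_id orth_one orth_mul.
Proof. by move=> u; apply: val_inj; rewrite /= bmulr1. Qed.
Fact orth_mulV : left_inverse orth_one orth_inv orth_mul.
Proof.
by move=> u; apply: val_inj; have /and3P[_ _ /eqP] := valP u.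
Qed.
Fact orth_mulrV : right_inverse orth_one orth_inv orth_mul.
Proof.
by move=> u; apply: val_inj; have /and3P[_ /eqP + _] := valP u.
Qed.
HB.instance Definition _ := isGroup.Build orth_group
  orth_mulA orth_mul1 orth_mulr1 orth_mulV orth_mulrV.
End OrthGroup.

Section TwistedDiagonal.
Variables G H : finGroupType.

(* Delta(alpha(S), alpha, S); the function alpha is only relevant on S. *)
Definition tdiag (alpha : H -> G) (S : {set H}) : {set G * H} :=
  [set (alpha s, s) | s in S].

Lemma tdiag_group_set (S : {group H}) (alpha : {morphism S >-> G}) :
  group_set (tdiag alpha S).
Proof.
apply/group_setP; split.
  by apply/imsetP; exists 1%g; rewrite ?group1// morph1.
move=> _ _ /imsetP[s sS ->] /imsetP[t tS ->].
by apply/imsetP; exists (s * t)%g; rewrite ?groupM// morphM.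
Qed.

Definition twisted_diagonal (L : {set G * H}) : Prop :=
  exists (R : {group G}) (S : {group H}) (alpha : {morphism S >-> G}),
    isom S R alpha /\ L = tdiag alpha S.

Definition td_reps : {set {group G * H}} :=
  orbit_transversal 'JG [set: G * H]
    [set L : {group G * H} | `[< twisted_diagonal L >]].

(* The standard basis element b = [(G x H)/L] has a non-zero coefficient in
   the expression of gamma in the standard basis. *)
Definition occurs (b gamma : biburnside G H) : Prop :=
  exists c : {group G * H} -> int,
    gamma = \sum_(L in td_reps) bcoset L *~ c L /\
    (exists2 L, L \in td_reps & b = bcoset L /\ c L != 0).

Definition uniform (gamma : biburnside G H) : Prop :=
  exists2 phi : {morphism [set: H] >-> G}, isom [set: H] [set: G] phi &
  exists c : {group H} -> int,
    gamma = \sum_(V : {group H}) bcoset (tdiag phi V) *~ c V.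

Lemma bcoset_Bdelta (L : {set G * H}) :
  twisted_diagonal L -> bcoset L \in Bdelta G H.
Proof.
move=> [R [S [alpha [/isomP[/injmP ai _] ->]]]]; apply: Bdelta_cls.
have LE (x : G * H) (A : coset_space (tdiag alpha S)) :
    coset_lact _ x A = A -> exists y : G * H, exists2 s, s \in S &
      (x ^ y)%g = (alpha s, s).
  case: A => A iA /(congr1 val) /=; have /lcosetsP[y _ ->] := iA => e.
  have: (y * (alpha 1, 1))%g \in (y *: tdiag alpha S)%g.
    by rewrite mem_lcoset mulKg; apply/imsetP; exists 1%g; rewrite ?group1.
  rewrite morph1 mulg1 -{1}e -lcosetM => /lcosetP[_ /imsetP[s sS ->]] e'.
  exists y, s^-1%g; rewrite ?groupV// morphV//.
  have xy : (x * y)%g = (y * (alpha s, s)^-1)%g by rewrite [in RHS]e' mulgK.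
  by rewrite conjgE xy mulKg.
split=> [g A|A h] /LE[[y1 y2] [s sS [e1 e2]]].
  move: e1; rewrite -e2 -[X in alpha X]/(1 ^ y2)%g conj1g morph1 => /eqP.
  by rewrite -[_ == _]/(g ^ y1 == 1)%g conjg_eq1 => /eqP.
have s1 : s = 1%g.
  apply: ai; rewrite ?group1// morph1 -e1.
  by rewrite -[LHS]/(1 ^ y1)%g conj1g.
apply/eqP; rewrite -invg_eq1 -(conjg_eq1 _ y2); apply/eqP.
by rewrite -[LHS]/(h^-1 ^ y2)%g [LHS]e2.
Qed.
End TwistedDiagonal.

Lemma bid_bcoset (G : finGroupType) : bid G = bcoset (tdiag id [set: G]).
Proof.
have gs := tdiag_group_set (idm [set: G]).
rewrite -[tdiag id _]/(gval (Group gs)); congr gcl.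
apply: (@cls_coset _ _ _ _ 1%g) => [y|[g h]].
  by exists (y, 1%g); rewrite /= mulg1 invg1 mulg1.
rewrite /= mulg1; split=> [e|/imsetP[s _ [-> ->]]]; last exact: mulgV.
apply/imsetP; exists h => //; congr pair.
by apply/eqP; rewrite eq_mulgV1 e.
Qed.

(* Main.v *)
From HB Require Import structures.
From mathcomp Require Import classical_sets cardinality.
From mathcomp Require Import all_boot all_order all_algebra all_fingroup.
From mathcomp Require Import all_solvable.
From mathcomp Require Import generic_quotient boolp.
From mathcomp Require Import ring zify.
Require Import Defs.

(** All five claims are read off from marks, that is, numbers of fixed points.

    For homomorphisms alpha : S -> G and beta : S -> H let m_u(alpha, beta) be
    the mark of u at the set of the pairs (alpha s, beta s); on a biset it
    counts the x with alpha(s) x = x beta(s) for all s. If x tensor y is fixed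
    in this sense in a product of bifree bisets, freeness provides a unique
    homomorphism through which S acts between x and y, whence the matrix
    identity [mark_bmul]
      |H| m_(u v)(alpha, gamma) = sum over beta of
                                  m_u(alpha, beta) m_v(beta, gamma).
    If u u^o = [G], the row of alpha therefore satisfies
      sum over beta of m_u(alpha, beta)^2 = |C_G(alpha(S))| |H|.
    The centralizers of alpha(S) and of beta(S) act freely on the points counted
    by m_u(alpha, beta), so both of their orders divide it. Hence the
    H-conjugates of a single beta with a non-zero mark already exhaust the sum:
    each row is supported on one H-class of homomorphisms, where the mark is
    the order of both centralizers up to sign [mark_row].

    For trivial alpha this says |G| = |H|; for the identity alpha of G it gives
    an isomorphism from G to H. Moreover the marks are bounded, and marks
    separate the elements of a Burnside ring, so the u with u u^o = [G] are
    finite in number. For G = H they form a finite right cancellative monoid,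
    which makes the one-sided inverse u^o two-sided; the general case reduces
    to this one by multiplying with an isomorphism [half_orth_bop]. The row of
    the identity of H in u^o is the class of isomorphisms phi : H -> G that
    occur in u.

    Let S be normal of prime index p in Q <= H and C the centralizer of phi(S).
    Counting orbits of an extension of Q by C gives, modulo p |C|,
      m_u(phi | S, S) = sum of m_u(tau, Q) over all extensions tau : Q -> G of
                        phi | S.
    If the mark at phi | Q is not zero, the extensions with a non-zero mark are
    its conjugates under C and the right-hand side is |C| up to sign, so the
    mark at phi | S is not zero either [mark_restrict_neq0]. When H is
    nilpotent, this descends from H to every subgroup V. As each column is
    supported on one class, the marks of u vanish outside the conjugates of the
    groups Delta(phi(V), phi, V), and by triangularity of the table of marks u
    is a combination of the corresponding cosets [orth_zspan_tdiag].

    The combinations of these cosets form the image of the injective map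
    [twist phi] from B(G). It satisfies (twist phi u) (twist psi (phi^* w)) =
    twist (phi psi) (u w), and twist phi u is orthogonal exactly when u^2 = 1,
    which holds exactly for the units u of B(G), all of whose marks are 1 or
    -1. So (u, x) |-> twist x u is an isomorphism from the semidirect product
    onto the orthogonal units. *)

Set Implicit Arguments.
Unset Strict Implicit.
Unset Printing Implicit Defensive.

Import GRing.Theory Num.Theory Order.TTheory.
Local Open Scope ring_scope.

(** * Integer spans and marks *)

Section IntegerSpan.
Variable A : zmodType.

Definition zspan (I : finType) (P : {pred I}) (e : I -> A) (u : A) : Prop :=
  exists c : I -> int, u = \sum_(i in P) e i *~ c i.

Lemma zspan_gen (I : finType) (P : {pred I}) e i :
  i \in P -> zspan P e (e i).
Proof.
move=> iP; exists (fun j => (j == i)%:Z); rewrite (bigD1 i)//= eqxx mulr1z.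
by rewrite big1 ?addr0// => j /andP[_ /negPf->].
Qed.

Lemma zspan0 (I : finType) (P : {pred I}) e : zspan P e 0.
Proof. by exists (fun=> 0); rewrite big1. Qed.

Lemma zspanD (I : finType) (P : {pred I}) e u v :
  zspan P e u -> zspan P e v -> zspan P e (u + v).
Proof.
move=> [c ->] [d ->]; exists (fun i => c i + d i).
by rewrite -big_split; apply: eq_bigr => i _; rewrite mulrzDr.
Qed.

Lemma zspanMz (I : finType) (P : {pred I}) e u n :
  zspan P e u -> zspan P e (u *~ n).
Proof.
move=> [c ->]; exists (fun i => c i * n).
by rewrite mulrz_suml; apply: eq_bigr => i _; rewrite mulrzA.
Qed.

Lemma zspan_trans (I J : finType) (P : {pred I}) (Q : {pred J}) e f u :
  zspan P e u -> (forall i, i \in P -> zspan Q f (e i)) -> zspan Q f u.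
Proof.
move=> [c ->] PQ; apply: (big_ind (zspan Q f)); first exact: zspan0.
  by move=> x y; apply: zspanD.
by move=> i /PQ; apply: zspanMz.
Qed.
End IntegerSpan.

Section Marks.
Variable K : finGroupType.

Definition fixpts (T : finType) (a : lact K T) (L : {set K}) : {set T} :=
  [set x | [forall g in L, a g x == x]].

Lemma fixptsP (T : finType) (a : lact K T) (L : {set K}) x :
  reflect (forall g, g \in L -> a g x = x) (x \in fixpts a L).
Proof.
rewrite inE; apply: (iffP forall_inP) => h g gL; first exact/eqP/h.
exact/eqP/h.
Qed.

Lemma card_fixpts (T U : finType) (a : lact K T) (b : lact K U) L M
    (f : T -> U) (f' : U -> T) : cancel f f' -> cancel f' f ->
    (forall x, x \in fixpts a L <-> f x \in fixpts b M) ->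
  #|fixpts a L| = #|fixpts b M|.
Proof.
move=> fK f'K fE; rewrite -(card_imset _ (can_inj fK)).
apply: eq_card => y; apply/imsetP/idP => [[x /fE xL ->] //|yM].
by exists (f' y); rewrite ?f'K//; apply/fE; rewrite f'K.
Qed.

Lemma card_fixpts_iso (T U : finType) (a : lact K T) (b : lact K U) L :
  lact_iso a b -> #|fixpts a L| = #|fixpts b L|.
Proof.
case=> f [[f' fK f'K] fE]; apply: (card_fixpts fK f'K) => x.
split=> /fixptsP h; apply/fixptsP => g /h e; first by rewrite -fE e.
by apply: (can_inj fK); rewrite fE.
Qed.

Fact mark_key : unit. Proof. exact: tt. Qed.

(** Locked, so that rewriting with ring identities does not unfold a mark into
    the difference of two cardinals. *)
Definition mark (L : {set K}) : burnside K -> int :=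
  locked_with mark_key
    (gext (fun x : gclass K => #|fixpts (gact (repr x)) L|%:Z)).

Fact card_fixptsD L :
  {morph (fun x : gclass K => #|fixpts (gact (repr x)) L|%:Z) : x y / x + y}.
Proof.
move=> x y; have -> : x + y = cls (sum_lact (gact (repr x))
    (gact (repr y))) by rewrite clsD -!cls_repr.
rewrite (card_fixpts_iso _ (cls_gact _)) -PoszD; congr Posz.
set a := gact (repr x); set b := gact (repr y).
rewrite -!sum1_card [LHS]big_sumType /=; congr addn; apply: eq_bigl => z.
  by apply/fixptsP/fixptsP => h g /h; [case|move=> /= ->].
by apply/fixptsP/fixptsP => h g /h; [case|move=> /= ->].
Qed.

Lemma mark_cl (T : finType) (a : lact K T) L :
  mark L (gcl (cls a)) = #|fixpts a L|%:Z.
Proof.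
rewrite /mark unlock (gext_cl (@card_fixptsD L)); congr Posz.
exact/card_fixpts_iso/cls_gact.
Qed.

Lemma markD L : {morph mark L : u v / u + v}.
Proof. by rewrite /mark unlock; exact: gextD (@card_fixptsD L). Qed.

Lemma markB L : {morph mark L : u v / u - v}.
Proof. by move=> u v; rewrite markD (morphN (markD L)). Qed.
HB.instance Definition _ L :=
  GRing.isZmodMorphism.Build (burnside K) int (mark L) (markB L).

Lemma markM L : {morph mark L : u v / u * v}.
Proof.
move=> u v; move: u; apply: groth_ext => [x y|x y|x].
- by rewrite mulrDl markD.
- by rewrite markD mulrDl.
move: v; apply: groth_ext => [y z|y z|y].
- by rewrite mulrDr markD.
- by rewrite markD mulrDr.
rewrite -gclM (cls_repr x) (cls_repr y) -clsM !mark_cl -PoszM -cardsX.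
congr Posz; apply: eq_card => -[s t]; rewrite in_setX.
apply/fixptsP/andP => [h|[/fixptsP h /fixptsP k] g gL].
  by split; apply/fixptsP => g /h [].
by rewrite /= /prod_fun h ?k.
Qed.

Lemma mark1 L : mark L 1 = 1.
Proof.
rewrite -[1 : burnside K]/(gcl (cls (triv_lact K unit))) mark_cl.
rewrite (_ : fixpts _ _ = setT) ?cardsT ?card_unit//.
by apply/setP=> -[]; rewrite !inE; apply/forall_inP.
Qed.

Lemma mark_conj L x u : mark (L :^ x)%g u = mark L u.
Proof.
move: u; apply: groth_ext; try exact: markD.
move=> y; rewrite (cls_repr y) !mark_cl; move: (gact _) => a.
congr Posz; apply: (card_fixpts (lactK a x) (lactKV a x)) => z.
split=> /fixptsP h; apply/fixptsP => g gL.
  by rewrite -lactM -[in RHS](h (g ^ x)%g) ?memJ_conjg// -lactM conjgE mulKVg.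
move: gL; rewrite mem_conjg => /h e.
apply: (@lact_inj _ _ a x); rewrite -[in RHS]e -!lactM conjgE invgK.
by rewrite !mulgA mulgKV.
Qed.

Lemma coset_elt_conj (L : {group K}) x :
  coset_elt (L :^ x)%g = coset_elt L.
Proof.
have ix : (x *: (L :^ x))%g \in lcosets (L :^ x)%g [set: K].
  by apply/lcosetsP; exists x; rewrite ?inE.
congr gcl; apply: (@cls_coset _ _ _ (coset_lact (L :^ x)%g)
  (Sub (x *: (L :^ x))%g ix)) => [[A iA]|g].
  have /lcosetsP[g _ e] := iA; exists (g * x^-1)%g.
  by apply: val_inj; rewrite /= -lcosetM mulgKV.
split=> [/(congr1 val)|gL]; last apply: val_inj => /=; last first.
  rewrite -lcosetM; apply/lcoset_eqP.
  by rewrite mem_lcoset -conjgE memJ_conjg.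
move=> /= /eqP; rewrite -lcosetM => /eqP/lcoset_eqP.
by rewrite mem_lcoset -conjgE memJ_conjg.
Qed.

Lemma mark_coset_elt_gt0 (L : {group K}) : 0 < mark L (coset_elt L).
Proof.
rewrite mark_cl ltz_nat card_gt0.
have iL : (1 *: L)%g \in lcosets L [set: K].
  by apply/lcosetsP; exists 1%g; rewrite ?inE.
apply/set0Pn; exists (Sub (1 *: L)%g iL); apply/fixptsP => g gL.
by apply: val_inj; rewrite /= lcoset1 lcoset_id.
Qed.

Lemma mark_coset_elt_neq0 (L : {set K}) (M : {group K}) :
  mark L (coset_elt M) != 0 -> exists x, L \subset (M :^ x)%g.
Proof.
rewrite mark_cl eqz_nat cards_eq0 => /set0Pn[[A iA] /fixptsP fA].
have /lcosetsP[x _ e] := iA; exists x^-1%g; apply/subsetP => g /fA /(congr1 val) /=.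
rewrite e -lcosetM => /lcoset_eqP.
by rewrite mem_lcoset mem_conjg invgK conjgE.
Qed.
End Marks.

(** * Standard bases and separation by marks *)

Section Spanning.
Variable K : finGroupType.

Definition stabilizer (T : finType) (a : lact K T) (x : T) : {set K} :=
  [set g | a g x == x].

Fact stabilizer_group_set (T : finType) (a : lact K T) x :
  group_set (stabilizer a x).
Proof.
apply/group_setP; split=> [|g h]; first by rewrite inE lact1.
by rewrite !inE lactM => /eqP e /eqP->; rewrite e.
Qed.
Canonical stabilizer_group (T : finType) (a : lact K T) x :=
  Group (stabilizer_group_set a x).

Section Invariant.
Variables (T : finType) (a : lact K T) (P : {pred T}).
Hypothesis aP : forall g x, x \in P -> a g x \in P.

Definition inv_fun g (x : {x | x \in P}) : {x | x \in P} :=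
  Sub (a g (val x)) (aP g (valP x)).
Fact inv_is_lact : is_lact inv_fun.
Proof. by split=> [x|g h x]; apply: val_inj; rewrite /= ?lact1 ?lactM. Qed.
Definition inv_lact := Lact inv_is_lact.
End Invariant.

Lemma cls_split (T : finType) (a : lact K T) (P : {set T})
    (aP : forall g x, x \in P -> a g x \in P)
    (aN : forall g x, x \in ~: P -> a g x \in ~: P) :
  cls a = cls (inv_lact aP) + cls (inv_lact aN).
Proof.
rewrite -clsD; apply/esym/clsP.
pose f (z : {x | x \in P} + {x | x \in ~: P}) :=
  match z with inl x => val x | inr x => val x end.
apply: (@lact_isoP _ _ _ _ _ f) => [z w|y|g [] //].
  case: z w => [z|z] [w|w] /= e.
  - by congr inl; apply: val_inj.
  - by move: (valP z) (valP w) => /=; rewrite e in_setC => ->.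
  - by move: (valP z) (valP w) => /=; rewrite e in_setC => /negPf->.
  by congr inr; apply: val_inj.
have [yP|yP] := boolP (y \in P); first by exists (inl (Sub y yP)).
by rewrite -in_setC in yP; exists (inr (Sub y yP)).
Qed.

Lemma gcl_cls_span (T : finType) (a : lact K T) :
  zspan setT (fun L : {group K} => coset_elt L) (gcl (cls a)).
Proof.
have [n] := ubnP #|T|; elim: n T a => // n IHn T a; rewrite ltnS => leT.
have [T0|] := boolP (#|T| == 0)%N; last first.
  rewrite -lt0n => /card_gt0P[x _].
  pose P := [set y in [seq a g x | g : K]].
  have mP y : reflect (exists g, y = a g x) (y \in P).
    by rewrite inE; apply: (iffP mapP) => [[g _ ->]|[g ->]]; exists g;
      rewrite ?mem_enum.
  have aP g y : y \in P -> a g y \in P.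
    by move=> /mP[h ->]; apply/mP; exists (g * h)%g; rewrite lactM.
  have aN g y : y \in ~: P -> a g y \in ~: P.
    rewrite !in_setC; apply: contra => /(aP g^-1%g).
    by rewrite lactK.
  have xP : x \in P by apply/mP; exists 1%g; rewrite lact1.
  rewrite (cls_split aP aN) gclD; apply: zspanD.
    rewrite (@cls_coset _ (stabilizer a x) _ (inv_lact aP) (Sub x xP)).
    - exact: (zspan_gen (fun L : {group K} => coset_elt L) (in_setT _)).
    - case=> y yP; have /mP[g e] := yP; exists g; exact: val_inj.
    move=> g; rewrite inE; split=> [/(congr1 val) /= ->|/eqP e] //.
    exact: val_inj.
  apply: IHn; rewrite card_sig; apply: leq_trans leT.
  rewrite -cardsT; apply/proper_card/properP.
  by split; [apply/subsetP => y; rewrite inE | exists x; rewrite // unfold_in /= in_setC xP].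
rewrite (_ : cls a = 0); first exact: zspan0.
have T0' (x : T) : False by have := fintype0 x; rewrite (eqP T0).
by apply/clsP/(@lact_isoP _ _ _ _ _ (fun x => False_rect void (T0' x))) => [x|[]|g x];
  case: (T0' x).
Qed.
End Spanning.

Section BurnsideSpan.
Variable K : finGroupType.
Local Notation cosets := (fun L : {group K} => coset_elt L).

Lemma burnside_zspan u : zspan setT cosets u.
Proof.
rewrite (grothE u) (cls_repr (repr u).1) (cls_repr (repr u).2) -mulrN1z.
by apply: zspanD; [|apply: zspanMz]; apply: gcl_cls_span.
Qed.

Variable F : {set {group K}}.
Hypothesis Fsub : forall L M : {group K}, M \in F -> L \subset M -> L \in F.
Hypothesis Fconj : forall (L : {group K}) x, L \in F -> (L :^ x)%G \in F.

(** Triangularity of the table of marks: in an expansion over class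
    representatives, let L be a largest group outside F with non-zero
    coefficient. The coset spaces with a point fixed by L belong to groups
    containing a conjugate of L, which lie outside F as well, so only [K/L]
    contributes to the mark at L, and this mark would not be 0. *)
Lemma burnside_zspan_sub u :
  (forall L : {group K}, L \notin F -> mark L u = 0) ->
  zspan (orbit_transversal 'JG [set: K] F) cosets u.
Proof.
move=> uF.
have act (S : {set {group K}}) :
    (forall (L : {group K}) x, L \in S -> (L :^ x)%G \in S) ->
    [acts [set: K], on S | 'JG].
  move=> Sconj; apply/subsetP => x _; rewrite !inE; apply/subsetP => L.
  by rewrite inE; apply: Sconj.
have actT : [acts [set: K], on [set: {group K}] | 'JG].
  by apply: act => L x _; rewrite inE.
have [_ X1 X2 X3] := orbit_transversalP actT.
have [_ Y1 Y2 Y3] := orbit_transversalP (act F Fconj).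
set X := orbit_transversal _ _ [set: _] in X1 X2 X3.
have [c uc] : zspan X cosets u.
  apply: zspan_trans (burnside_zspan u) _ => L _.
  have [|x _ xX] := X3 L; first by rewrite inE.
  rewrite -(coset_elt_conj L x); exact: (zspan_gen cosets xX).
have cF L : L \in X -> L \notin F -> c L = 0.
  have [n] := ubnP (#|K| - #|L|); elim: n L => // n IHn L.
  rewrite ltnS => leL XL FL; have := uF L FL; rewrite uc raddf_sum /=.
  rewrite (bigD1 L)//= big1 ?addr0 => [|M /andP[XM neM]].
    rewrite raddfMz -mulrzr => /eqP; rewrite mulf_eq0 intr_eq0 gt_eqF//=.
      by move/eqP.
    exact: mark_coset_elt_gt0.
  rewrite raddfMz /=; have [->|] := eqVneq (mark L (coset_elt M)) 0.
    by rewrite mul0rz.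
  move=> /mark_coset_elt_neq0[x LM].
  have FM : M \notin F.
    apply: contra FL => FM; apply: Fsub LM; exact: (Fconj x FM).
  have : (#|L| <= #|(M :^ x)%g|)%N := subset_leq_card LM.
  rewrite leq_eqVlt => /orP[/eqP e|lt].
    case/negP: neM; rewrite eq_sym -(X2 L M)//; apply/orbitP.
    exists x^-1%g; rewrite ?inE//; apply: val_inj => /=.
    have /eqP-> : L :==: (M :^ x)%g by rewrite eqEcard LM e leqnn.
    by rewrite conjsgK.
  rewrite IHn ?mulr0z//; apply: leq_trans leL.
  rewrite cardJg in lt; apply: ltn_sub2l => //.
  exact: leq_trans lt (max_card _).
apply: zspan_trans (_ : zspan (X :&: F) cosets u) _; last first.
  move=> L /setIP[_ FL]; have [x _ xX] := Y3 L FL.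
  rewrite -(coset_elt_conj L x); exact: (zspan_gen cosets xX).
exists c; rewrite uc (big_setID F)/= [X in _ + X]big1 ?addr0// => L.
by rewrite inE => /andP[FL XL]; rewrite cF ?mulr0z.
Qed.
End BurnsideSpan.

(** Burnside's theorem, the case of an empty family. *)
Lemma mark_inj (K : finGroupType) (u v : burnside K) :
  (forall L : {group K}, mark L u = mark L v) -> u = v.
Proof.
move=> e; apply/eqP; rewrite -subr_eq0; apply/eqP.
have [||L _|c ->] := @burnside_zspan_sub K set0 _ _ (u - v).
- by move=> L M; rewrite inE.
- by move=> L x; rewrite inE.
- by rewrite raddfB /= e subrr.
have act0 : [acts [set: K], on (@set0 {group K}) | 'JG].
  by apply/subsetP => x _; rewrite !inE; apply/subsetP => L; rewrite inE.
have [_ X0 _ _] := orbit_transversalP act0.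
by rewrite big1// => L /(subsetP X0); rewrite inE.
Qed.

(** * Marks of tensor products *)

Section Homs.
Variables S G : finGroupType.

Definition homs : {set {ffun S -> G}} :=
  [set f : {ffun S -> G} | [forall s, forall t, f (s * t)%g == (f s * f t)%g]].

Lemma homsP (f : {ffun S -> G}) :
  reflect {morph f : s t / (s * t)%g} (f \in homs).
Proof.
rewrite inE; apply: (iffP forallP) => [h s t|h s].
  by have /forallP/(_ t)/eqP := h s.
by apply/forallP => t; rewrite h.
Qed.
End Homs.

Section Graphs.
Variables S G H : finGroupType.

Definition graph (alpha : S -> G) (beta : S -> H) : {set G * H} :=
  [set (alpha s, beta s) | s : S].

Lemma graph_fixP (T : finType) (a : lact (G * H)%type T) alpha beta x :
  reflect (forall s, lmul a (alpha s) x = rmul a x (beta s))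
    (x \in fixpts a (graph alpha beta)).
Proof.
have E s : a (alpha s, beta s) x = x <->
    lmul a (alpha s) x = rmul a x (beta s).
  rewrite bimulE /=; split=> [e|->]; last by rewrite -rmulM mulgV rmul1.
  by rewrite -[in RHS]e -rmulM mulVg rmul1.
apply: (iffP (fixptsP _ _ _)) => [h s|h _ /imsetP[s _ ->]].
  by apply/E/h; exact: imset_f.
exact/E.
Qed.

Lemma mark_graph_conj (alpha : S -> G) (beta : S -> H) g h u :
  mark (graph (fun s => alpha s ^ g)%g (fun s => beta s ^ h)%g) u =
  mark (graph alpha beta) u.
Proof.
rewrite -[RHS](mark_conj _ (g, h)) /graph; congr (mark _ u).
by rewrite /conjugate -[in RHS]imset_comp.
Qed.

Lemma mark_graph_conjl (alpha : S -> G) (beta : S -> H) g u :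
  mark (graph (fun s => alpha s ^ g)%g beta) u = mark (graph alpha beta) u.
Proof.
rewrite -(mark_graph_conj alpha beta g 1); congr (mark (graph _ _) u).
by apply/funext => s; rewrite conjg1.
Qed.

(** Properties compatible with differences extend from bifree bisets to the
    whole of B^Delta(G, H). *)
Lemma Bdelta_ind (P : biburnside G H -> Prop) :
    (forall (T : finType) (a : lact (G * H)%type T),
       bifree a -> P (gcl (cls a))) ->
    (forall u v, P u -> P v -> P (u - v)) ->
  forall u, u \in Bdelta G H -> P u.
Proof.
by move=> Pb PB u /BdeltaP[T [U [a [b [af bf ->]]]]]; apply: PB; apply: Pb.
Qed.
End Graphs.

Lemma mark_bop (S G H : finGroupType) (alpha : S -> G) (beta : S -> H)
    (u : biburnside G H) :
  mark (graph beta alpha) (bop u) = mark (graph alpha beta) u.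
Proof.
move: u; apply: groth_ext => [u v|u v|x].
- by rewrite bopD markD.
- exact: markD.
rewrite (cls_repr x) bop_cl !mark_cl; congr Posz; apply: eq_card => y.
by apply/fixptsP/fixptsP => h _ /imsetP[s _ ->]; apply: (h (_, _)); apply: imset_f.
Qed.

Section TensorMarks.
Variables S G H K : finGroupType.

(** Freeness of H on the left of U makes the orbits of H on T x U regular, and
    attaches to each fixed x tensor y exactly one homomorphism beta with
    alpha(s) x = x beta(s) and beta(s) y = y gamma(s): these are the two sides
    of a double count of the pairs (x, y). *)
Lemma card_fix_tensor (T U : finType) (a : lact (G * H)%type T)
    (b : lact (H * K)%type U) (alpha : S -> G) (gamma : S -> K) :
    bifree b -> {morph gamma : s t / (s * t)%g} ->
  (#|H| * #|fixpts (tensor_lact a b) (graph alpha gamma)| =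
   \sum_(beta in homs S H)
     #|fixpts a (graph alpha beta)| * #|fixpts b (graph beta gamma)|)%N.
Proof.
move=> [bl br] gM; set Fix := fixpts _ _.
have bl' y h h' : lmul b h y = lmul b h' y -> h = h'.
  move=> e; apply/eqP; rewrite eq_mulVg1 -invg_eq1 invMg invgK; apply/eqP.
  by apply: (bl _ y); rewrite lmulM e -lmulM mulVg lmul1.
pose P := [set p : T * U | tens a b p.1 p.2 \in Fix].
transitivity #|P|.
  rewrite -[RHS]sum1_card (partition_big (fun p => tens a b p.1 p.2)
    (mem Fix)) /=; last by move=> p; rewrite inE.
  rewrite mulnC -sum_nat_const; apply: eq_bigr => A FA.
  have [x [y eA]] := tensorP A; rewrite sum1dep_card.
  pose f h := mid_act a b h (x, y).
  have fi : injective f by move=> h h' [_ /bl'].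
  rewrite -cardsT -(card_imset _ fi); apply: eq_card => -[x' y'].
  rewrite inE [_ \in P]inE; apply/imsetP/andP => [[h _ [-> ->]]|[_ /eqP]] /=.
    suff -> : tens a b (rmul a x h^-1) (lmul b h y) = A by rewrite FA eqxx.
    by rewrite eA; apply/tens_eq; exists h.
  by rewrite eA => /tens_eq[h [-> ->]]; exists h.
pose X (beta : {ffun S -> H}) :=
  setX (fixpts a (graph alpha beta)) (fixpts b (graph beta gamma)).
transitivity (\sum_(p : T * U) \sum_(beta in homs S H | p \in X beta) 1)%N.
  rewrite -sum1_card big_mkcond; apply: eq_bigr => -[x y] _.
  have -> : ((x, y) \in P) = (tens a b x y \in Fix) by rewrite inE.
  rewrite sum1dep_card.
  case: ifP => [/graph_fixP xyF|/negP xyF]; last first.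
    apply/esym/eqP; rewrite cards_eq0; apply/eqP/setP => beta.
    rewrite in_set0 in_set in_setX; apply/negP.
    move=> /andP[_ /andP[/graph_fixP xF /graph_fixP yF]].
    apply: xyF; apply/graph_fixP => s.
    by rewrite lmul_tens rmul_tens xF -yF tens_balanced.
  have ex s : exists h,
      (lmul a (alpha s) x == rmul a x h) && (lmul b h y == rmul b y (gamma s)).
    have := xyF s; rewrite lmul_tens rmul_tens => /tens_eq[h [e1 e2]].
    exists h^-1%g; rewrite e1 eqxx {1}e2 -lmulM mulVg lmul1.
    exact: eqxx.
  pose beta : {ffun S -> H} := [ffun s => xchoose (ex s)].
  have be s : lmul a (alpha s) x = rmul a x (beta s) /\
      lmul b (beta s) y = rmul b y (gamma s).
    by rewrite ffunE; have /andP[/eqP ? /eqP ?] := xchooseP (ex s).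
  suff -> : [set i in homs S H | (x, y) \in X i] = [set beta].
    by rewrite cards1.
  apply/setP => i; rewrite in_set in_set1 in_setX.
  apply/andP/eqP => [[_ /andP[_ /graph_fixP h]]|->].
    by apply/ffunP => s; apply: (bl' y); rewrite h (be s).2.
  split; last by apply/andP; split; apply/graph_fixP => s; have [] := be s.
  apply/homsP => s t; apply: (bl' y).
  by rewrite lmulM !(be _).2 lrmulC (be _).2 -rmulM gM.
rewrite (exchange_big_dep (mem (homs S H))) => [|p beta _ /andP[]//] /=.
apply: eq_bigr => beta /= bh; rewrite -cardsX sum1dep_card; apply: eq_card => p.
by rewrite in_set bh.
Qed.

Lemma mark_bmul (u : biburnside G H) (v : biburnside H K) (alpha : S -> G)
    (gamma : S -> K) :
    v \in Bdelta H K -> {morph gamma : s t / (s * t)%g} ->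
  mark (graph alpha gamma) (bmul u v) *+ #|H| =
  \sum_(beta in homs S H)
    mark (graph alpha beta) u * mark (graph beta gamma) v.
Proof.
move=> vB gM; move: v vB; apply: Bdelta_ind => [U b bf|v w IHv IHw]; last first.
  rewrite bmulDr bmulNr markB mulrnBl IHv IHw -sumrB.
  by apply: eq_bigr => beta _; rewrite markB [RHS]mulrBr.
move: u; apply: groth_ext => [u v|u v|x].
- by rewrite bmulDl markD mulrnDl.
- by rewrite -big_split; apply: eq_bigr => beta _; rewrite markD mulrDl.
rewrite (cls_repr x) bmul_cl mark_cl -mulr_natr natz -PoszM mulnC.
rewrite card_fix_tensor// -[Posz _]natz natr_sum.
by apply: eq_bigr => beta _; rewrite !mark_cl natz PoszM.
Qed.
End TensorMarks.

(** * Rows of orthogonal elements *)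

Section OrbitCount.
Variables (K : finGroupType) (T : finType) (a : lact K T).

Fact lact_act1 : (fun x g => a g^-1%g x)^~ 1%g =1 id.
Proof. by move=> x; rewrite invg1 lact1. Qed.
Fact lact_actM x : act_morph (fun x g => a g^-1%g x) x.
Proof. by move=> g h; rewrite invMg lactM. Qed.
Definition lact_action : {action K &-> T} := TotalAction lact_act1 lact_actM.

Lemma card_stabilizer_dvd (W : {group K}) (Z : {set T}) n :
    (forall w x, w \in W -> x \in Z -> a w x \in Z) ->
    (forall x, x \in Z -> #|W :&: stabilizer a x| = n) ->
  (#|W| %| #|Z| * n)%N.
Proof.
move=> WZ Wn; have aW : [acts W, on Z | lact_action].
  apply/subsetP => w Ww; rewrite !inE; apply/subsetP => x xZ.
  by rewrite inE /= WZ ?groupV.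
rewrite -(acts_sum_card_orbit aW) big_distrl /=.
apply: dvdn_sum => _ /imsetP[x xZ ->].
rewrite -(Wn x xZ) -(card_orbit_stab lact_action W x).
rewrite (_ : 'C_W[x | lact_action]%g = W :&: stabilizer a x)//.
apply/setP => w; rewrite !inE sub1set inE /=; congr (_ && _).
by rewrite -(inj_eq (@lact_inj _ _ a w)) lactKV eq_sym.
Qed.
End OrbitCount.

Section Centralizers.
Variables S G H : finGroupType.

Definition centralizer (alpha : S -> G) : {group G} :=
  'C((alpha @: [set: S])%SET)%G.

Lemma centralizerP (alpha : S -> G) g :
  reflect (forall s, alpha s * g = g * alpha s)%g (g \in centralizer alpha).
Proof.
apply: (iffP centP) => [h s|h _ /imsetP[s _ ->]]; last exact/esym/h.
by rewrite h// imset_f.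
Qed.

Lemma mark_bid (alpha : S -> G) :
  mark (graph alpha alpha) (bid G) = #|centralizer alpha|%:Z.
Proof.
rewrite mark_cl; congr Posz; apply: eq_card => g.
apply/graph_fixP/centralizerP => h s; have := h s;
  by rewrite /lmul /rmul /= invg1 mulg1 invgK mul1g.
Qed.

(** The centralizer of alpha(S) acts freely from the left on the fixed points. *)
Lemma centralizer_dvd_mark (alpha : S -> G) (beta : S -> H) u :
  u \in Bdelta G H -> (#|centralizer alpha|%:Z %| mark (graph alpha beta) u)%Z.
Proof.
move: u; apply: Bdelta_ind => [T a [al _]|u v]; last by rewrite markB; apply: rpredB.
rewrite mark_cl dvdzE /=; set Z := fixpts _ _.
pose W := setX_group (centralizer alpha) [1 H]%G.
have cW : #|W| = #|centralizer alpha| by rewrite cardsX cards1 muln1.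
rewrite -cW -(muln1 #|Z|); apply: (@card_stabilizer_dvd _ _ a).
  move=> [c h] x /setXP[/= cC /set1P->] /graph_fixP xZ; apply/graph_fixP => s.
  rewrite -/(lmul a c x) -lmulM (centralizerP _ _ cC) lmulM xZ.
  by rewrite lrmulC.
move=> x _; apply/eqP/cards1P; exists 1%g; apply/setP => -[c h].
apply/idP/idP => [/setIP[/setXP[_ /set1P->]]|/set1P->]; last exact: group1.
by rewrite [_ \in stabilizer _ _]inE => /eqP e; rewrite (al _ _ e); exact: set11.
Qed.
End Centralizers.

Lemma centralizer_dvd_mark_r (S G H : finGroupType) (alpha : S -> G)
    (beta : S -> H) u :
  u \in Bdelta G H -> (#|centralizer beta|%:Z %| mark (graph alpha beta) u)%Z.
Proof.
by move=> uB; rewrite -mark_bop; apply/centralizer_dvd_mark/bop_Bdelta.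
Qed.

Section OrthogonalRows.
Variables (G H : finGroupType) (u : biburnside G H).
Hypotheses (uB : u \in Bdelta G H) (uu : bmul u (bop u) = bid G).
Variables (S : finGroupType) (alpha : S -> G).
Hypothesis alphaM : {morph alpha : s t / (s * t)%g}.

Lemma sum_mark_sqr :
  \sum_(beta in homs S H) mark (graph alpha beta) u ^+ 2 =
  #|centralizer alpha|%:Z * #|H|%:Z.
Proof.
have := mark_bmul u alpha (bop_Bdelta uB) alphaM.
rewrite uu mark_bid -mulr_natr natz => ->; apply: eq_bigr => beta _.
by rewrite mark_bop expr2.
Qed.

Lemma mark_neq0_ex :
  exists2 beta, beta \in homs S H & mark (graph alpha beta) u != 0.
Proof.
have [/exists_inP//|/exists_inPn h] :=
  boolP [exists beta in homs S H, mark (graph alpha beta) u != 0].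
have := sum_mark_sqr; rewrite big1 => [/esym/eqP|beta /h/negPn/eqP->]; last first.
  by rewrite expr0n.
by rewrite mulf_eq0 !eqz_nat !gtn_eqF ?cardG_gt0// -cardsT cardG_gt0.
Qed.

Section Row.
Variable beta : {ffun S -> H}.
Hypothesis betaM : beta \in homs S H.

Definition conj_hom (h : H) : {ffun S -> H} := [ffun s => beta s ^ h]%g.

Lemma conj_hom_homs h : conj_hom h \in homs S H.
Proof.
by apply/homsP => s t; rewrite !ffunE (homsP _ betaM) conjMg.
Qed.

(** The elements conjugating beta to a given homomorphism form a coset of the
    centralizer, or there are none. *)
Lemma card_conj_hom (beta' : {ffun S -> H}) :
  (#|[set h | conj_hom h == beta']| <= #|centralizer beta|)%N.
Proof.
have [->|/set0Pn[k]] := eqVneq [set h | conj_hom h == beta'] set0.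
  by rewrite cards0.
rewrite inE => /eqP <-; rewrite -(card_rcoset (centralizer beta) k).
apply/subset_leq_card/subsetP => h; rewrite inE => /eqP/ffunP e.
rewrite mem_rcoset; apply/centralizerP => s; have := e s; rewrite !ffunE.
by move/(congr1 (conjg^~ k^-1%g)); rewrite -!conjgM mulgV conjg1 => {2}<-; rewrite -conjgC.
Qed.

Hypothesis mn0 : mark (graph alpha beta) u != 0.

(** Summing the squared marks over all h in H at the conjugates of beta counts
    each homomorphism at most |C_H(beta(S))| times, so it is bounded by the
    total over the row; a homomorphism that is not conjugate to beta leaves
    room for its own contribution. *)
Lemma conj_row_bound (beta' : {ffun S -> H}) :
    beta' \in homs S H ->
  #|H|%:Z * mark (graph alpha beta) u ^+ 2 +
    (if [exists h, conj_hom h == beta'] then 0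
     else #|centralizer beta|%:Z * mark (graph alpha beta') u ^+ 2) <=
  #|centralizer beta|%:Z * (#|centralizer alpha|%:Z * #|H|%:Z).
Proof.
move=> b'h; pose m (b : {ffun S -> H}) := mark (graph alpha b) u ^+ 2.
rewrite -sum_mark_sqr mulr_sumr.
have -> : #|H|%:Z * mark (graph alpha beta) u ^+ 2 =
    \sum_(b in homs S H) #|[set h | conj_hom h == b]|%:Z * m b.
  transitivity (\sum_(h : H) m (conj_hom h)).
    rewrite -[#|H|%:Z]natz mulr_natl -sumr_const; apply: eq_big => // h _.
    rewrite /m -(mark_graph_conj alpha beta 1%g h); congr (mark (graph _ _) u ^+ 2).
      by apply/funext => s; rewrite conjg1.
    by apply/funext => s; rewrite ffunE.
  rewrite (partition_big conj_hom (mem (homs S H))) => [|h _]; last first.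
    exact: conj_hom_homs.
  apply: eq_bigr => b _; rewrite (eq_bigr (fun=> m b)) => [|h /eqP->] //.
  by rewrite sumr_const -mulr_natl natz; congr (_%:Z * _); apply: eq_card => h; rewrite !inE.
rewrite (bigD1 beta')//= [leRHS](bigD1 beta')//= addrAC; apply: lerD; last first.
  apply: ler_sum => b _; rewrite ler_wpM2r ?sqr_ge0// lez_nat.
  exact: card_conj_hom.
case: ifP => [_|/negbT/existsPn h].
  by rewrite addr0 ler_wpM2r ?sqr_ge0// lez_nat card_conj_hom.
rewrite (_ : [set _ | _] = set0) ?cards0 ?mul0r ?add0r//.
by apply/setP => k; rewrite !inE (negPf (h k)).
Qed.

(** Divisibility by both centralizer orders makes the class of beta contribute
    at least the whole sum of the row, so it contributes exactly that. *)
Lemma mark_row :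
  [/\ #|centralizer alpha| = #|centralizer beta|,
      `|mark (graph alpha beta) u| = #|centralizer alpha|%:Z &
      forall beta' : {ffun S -> H}, beta' \in homs S H ->
        mark (graph alpha beta') u != 0 ->
      exists h, forall s, beta' s = (beta s ^ h)%g].
Proof.
have /dvdzP[p ep] := centralizer_dvd_mark alpha beta uB.
have /dvdzP[q eq] := centralizer_dvd_mark_r alpha beta uB.
have cG0 : 0 < #|centralizer alpha|%:Z :> int by rewrite ltz_nat cardG_gt0.
have cH0 : 0 < #|centralizer beta|%:Z :> int by rewrite ltz_nat cardG_gt0.
have H0 : 0 < #|H|%:Z :> int by rewrite ltz_nat -cardsT cardG_gt0.
have mn := mn0; set m := mark (graph alpha beta) u in mn ep eq *.
set a := #|centralizer alpha|%:Z in ep cG0 *.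
set b := #|centralizer beta|%:Z in eq cH0 *.
(* m ^ 2 = p q a b with p q a positive integer, so a b is at most m ^ 2; the
   bound on the row of alpha is the opposite inequality. *)
have mm : m ^+ 2 = (p * q) * (a * b) by rewrite expr2 {1}ep eq mulrACA.
have ab0 : 0 < a * b by rewrite mulr_gt0.
have pq0 : 0 < p * q.
  by rewrite -(pmulr_lgt0 _ ab0) -mm exprn_even_gt0.
have bound beta' (b'h : beta' \in homs S H) := conj_row_bound b'h.
have pq1 : p * q <= 1.
  have := bound _ betaM; case: ifP => [_|/existsP[]]; last first.
    by exists 1%g; apply/eqP/ffunP => s; rewrite !ffunE conjg1.
  rewrite addr0 -/m -/a -/b mm (_ : b * _ = #|H|%:Z * (1 * (a * b))); last by ring.
  by rewrite ler_pM2l// ler_pM2r.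
have {pq0 pq1} pq : p * q = 1 by apply/le_anti; rewrite pq1.
have /eqP := congr1 absz pq; rewrite abszM muln_eq1 => /andP[/eqP p1 /eqP q1].
have ma : `|m| = a by rewrite ep normrM -abszE p1 mul1r gtr0_norm.
have mb : `|m| = b by rewrite eq normrM -abszE q1 mul1r gtr0_norm.
split=> [||beta' b'h m'n0] //; first by apply/eqP; rewrite -eqz_nat -/a -/b -ma mb.
have := bound beta' b'h; case: ifP => [/existsP[h /eqP<-] _|_].
  by exists h => s; rewrite ffunE.
rewrite -/m -/a -/b mm pq mul1r (_ : b * (a * _) = #|H|%:Z * (a * b)); last by ring.
by rewrite gerDl pmulr_rle0// leNgt exprn_even_gt0// m'n0.
Qed.
End Row.
End OrthogonalRows.

(** * Bifree marks, finiteness and one-sided inverses *)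

Section BifreeMarks.
Variables G H : finGroupType.

Lemma mark_Bdelta_free (u : biburnside G H) L :
    u \in Bdelta G H -> mark L u != 0 ->
  forall p, p \in L -> (p.1 == 1%g) = (p.2 == 1%g).
Proof.
move=> uB mL p pL; apply/eqP/eqP => e; apply/eqP/negPn/negP => ne;
  case/negP: mL; move: u uB; apply: Bdelta_ind => [T a [al ar]|u v];
  try (by rewrite markB => /eqP-> /eqP->);
  rewrite mark_cl eqz_nat cards_eq0; apply/set0Pn => -[x /fixptsP/(_ p pL)].
  case: p e ne {pL} => g h /= -> ne e; case/negP: ne.
  by rewrite -invg_eq1; apply/eqP/(ar x); rewrite /rmul invgK.
by case: p e ne {pL} => g h /= -> ne e; case/negP: ne; apply/eqP/(al _ x).
Qed.

(** Goursat's lemma for subgroups meeting both factors trivially; in this form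
    the property visibly passes to subgroups and conjugates. *)
Lemma twisted_diagonalP (L : {group G * H}) :
  twisted_diagonal L <-> forall p, p \in L -> (p.1 == 1%g) = (p.2 == 1%g).
Proof.
split=> [[R [S [alpha [/isomP[ai _] eL]]]] p|Lf].
  by rewrite eL => /imsetP[s sS ->] /=; rewrite morph_injm_eq1.
have Lu g g' h : (g, h) \in L -> (g', h) \in L -> g = g'.
  move=> gL g'L; apply/eqP; rewrite eq_mulgV1.
  have := groupM gL (groupVr g'L) => /Lf /= ->.
  exact/eqP/mulgV.
pose alpha h : G := odflt 1%g [pick g | (g, h) \in L].
have alphaE g h : (g, h) \in L -> alpha h = g.
  rewrite /alpha => gL; case: pickP => [g' /= /Lu/(_ gL) //|/(_ g)].
  by rewrite gL.
pose S := (snd_morphism G H @* L)%G.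
have SP h : reflect (exists g, (g, h) \in L) (h \in S).
  rewrite /= morphimEsub ?subsetT//.
  by apply: (iffP imsetP) => [[[g k] gL ->]|[g gL]]; [exists g | exists (g, h)].
have alphaM : {in S &, {morph alpha : h k / (h * k)%g}}.
  move=> h k /SP[g gL] /SP[g' g'L]; rewrite (alphaE _ _ gL) (alphaE _ _ g'L).
  exact: alphaE (groupM gL g'L).
pose f := Morphism alphaM; exists (f @* S)%G, S, f; split.
  apply/isomP; split=> //; apply/subsetP => h /[!inE] /andP[/SP[g gL]].
  by rewrite /= (alphaE _ _ gL) => g1; rewrite -(Lf _ gL).
apply/setP => -[g h]; apply/idP/imsetP => [gL|[k /SP[g' gL] [-> ->]]].
  by exists h; [apply/SP; exists g | rewrite /= (alphaE _ _ gL)].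
by rewrite /= (alphaE _ _ gL).
Qed.

Lemma tdiag_graph (S : {group H}) (alpha : H -> G) :
  tdiag alpha S = graph (fun s : subg_of S => alpha (sgval s)) sgval.
Proof.
apply/setP => p; apply/imsetP/imsetP => [[s sS ->]|[s _ ->]].
  by exists (subg S s); rewrite ?subgK.
by exists (sgval s); rewrite ?subgP.
Qed.

Lemma mark_Bdelta_tdiag (u : biburnside G H) (L : {group G * H}) :
  u \in Bdelta G H -> mark L u != 0 -> twisted_diagonal L.
Proof. by move=> uB mL; apply/twisted_diagonalP/(mark_Bdelta_free uB). Qed.

Lemma sgval_hom (S : {group H}) (alpha : {morphism S >-> G}) :
  {morph (fun s : subg_of S => alpha (sgval s)) : s t / (s * t)%g}.
Proof. by move=> s t; rewrite /= morphM ?subgP. Qed.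

Lemma twisted_diagonal_conj (L : {group G * H}) x :
  twisted_diagonal L -> twisted_diagonal (L :^ x)%g.
Proof.
move=> /twisted_diagonalP Lf; apply/(twisted_diagonalP (L :^ x)%G).
case: x => x y _ /imsetP[[g h] /Lf /= e ->].
by rewrite -[X in X == _ = _]/(g ^ x)%g -[X in _ = (X == _)]/(h ^ y)%g !conjg_eq1.
Qed.

Lemma Bdelta_zspan u : u \in Bdelta G H ->
  zspan (td_reps G H) (fun L : {group G * H} => bcoset L) u.
Proof.
move=> uB; apply: burnside_zspan_sub => [L M|L x|L].
- rewrite !inE => /asboolP/twisted_diagonalP Mf LM.
  by apply/asboolP/twisted_diagonalP => p /(subsetP LM)/Mf.
- by rewrite !inE => /asboolP Lt; apply/asboolP/twisted_diagonal_conj.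
rewrite inE => /asboolP Lt; apply/eqP/negPn/negP => mL; apply: Lt.
exact: mark_Bdelta_tdiag mL.
Qed.
End BifreeMarks.

Section HalfOrthogonal.
Variables G H : finGroupType.

Definition half_orth (u : biburnside G H) : Prop :=
  u \in Bdelta G H /\ bmul u (bop u) = bid G.

Lemma half_orth_row (S : finGroupType) u (alpha : S -> G) (beta : S -> H) :
    half_orth u -> {morph alpha : s t / (s * t)%g} ->
    {morph beta : s t / (s * t)%g} -> mark (graph alpha beta) u != 0 ->
  [/\ #|centralizer alpha| = #|centralizer beta|,
      `|mark (graph alpha beta) u| = #|centralizer alpha|%:Z &
      forall beta' : S -> H, {morph beta' : s t / (s * t)%g} ->
        mark (graph alpha beta') u != 0 ->
      exists h, forall s, beta' s = (beta s ^ h)%g].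
Proof.
move=> [uB uu] aM bM.
have E (b : S -> H) : finfun b = b :> (S -> H).
  by apply/funext => s; rewrite ffunE.
have fM (b : S -> H) : {morph b : s t / (s * t)%g} -> finfun b \in homs S H.
  by move=> h; apply/homsP => s t; rewrite !ffunE.
rewrite -{1}(E beta) => /(mark_row uB uu aM (fM _ bM)).
rewrite (E beta) => -[c1 c2 c3]; split=> // b' b'M; rewrite -(E b') => mn'.
exact: c3 (fM _ b'M) mn'.
Qed.

Lemma half_orth_mark_le u L : half_orth u -> `|mark (gval L) u| <= #|G|%:Z.
Proof.
move=> hu; have [->|mL] := eqVneq (mark L u) 0; first by rewrite normr0.
have [R [S [alpha [_ eL]]]] := mark_Bdelta_tdiag hu.1 mL.
rewrite eL tdiag_graph in mL *.
have [_ -> _] := half_orth_row hu (sgval_hom alpha) (fun _ _ => erefl) mL.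
by rewrite lez_nat max_card.
Qed.

(** The marks of an element with u u^o = [G] lie between -|G| and |G|, so the
    shift by |G| encodes them as natural numbers without loss. *)
Definition mark_code (u : biburnside G H) :
    {ffun {group G * H} -> 'I_(#|G| + #|G|).+1} :=
  [ffun L => inord (absz (mark (gval L) u + #|G|%:Z))].

Lemma mark_code_inj u v :
  half_orth u -> half_orth v -> mark_code u = mark_code v -> u = v.
Proof.
move=> hu hv /ffunP e; apply: mark_inj => L; have := e L; rewrite !ffunE.
have := half_orth_mark_le L hu; have := half_orth_mark_le L hv.
move: (mark L u) (mark L v) => m n; rewrite !ler_norml.
move=> /andP[n1 n2] /andP[m1 m2] /(congr1 val) /=.
move: #|G| n1 n2 m1 m2 => N n1 n2 m1 m2; rewrite !inordK; lia.
Qed.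

Lemma half_orth_finite : finite_set [set u | half_orth u]%classic.
Proof.
pose g c := xget 0 [set u | half_orth u /\ mark_code u = c]%classic.
have fin := finite_image g (@finite_finset _ classical_sets.setT).
apply: (sub_finite_set _ fin).
move=> u hu; exists (mark_code u) => //.
have [] := @xgetPex _ 0 [set v | half_orth v /\ mark_code v = mark_code u]%classic.
  by exists u.
by move=> hg; apply: mark_code_inj.
Qed.
End HalfOrthogonal.

Lemma half_orthM (G H K : finGroupType) (u : biburnside G H)
    (v : biburnside H K) :
  half_orth u -> half_orth v -> half_orth (bmul u v).
Proof.
move=> [uB uu] [vB vv]; split; first exact: bmul_Bdelta.
by rewrite bopM -bmulA [X in bmul u X]bmulA vv bmul1 uu.
Qed.

Lemma half_orth1 (G : finGroupType) : half_orth (bid G).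
Proof. by split; rewrite ?bid_Bdelta// bop1 bmul1. Qed.

(** The v with v v^o = [G] form a finite monoid, so two powers of u coincide;
    cancelling u on the right, which u^o allows, leaves a left inverse of u. *)
Lemma half_orth_inv (G : finGroupType) (u : biburnside G G) :
  half_orth u -> bmul (bop u) u = bid G.
Proof.
move=> hu; pose pw := fix pw n := if n is m.+1 then bmul (pw m) u else bid G.
have hpw n : half_orth (pw n).
  by elim: n => [|n IHn]; [apply: half_orth1 | apply: half_orthM].
have [i [j [ltij eij]]] : exists i j, (i < j)%N /\ pw i = pw j.
  pose F := {ffun {group G * G} -> 'I_(#|G| + #|G|).+1}.
  pose f (i : 'I_#|F|.+1) : F := mark_code (pw i).
  have /injectivePn[i [j neij /mark_code_inj eij]] : ~~ injectiveb f.
    by apply/negP => /injectiveP/leq_card; rewrite card_ord ltnn.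
  have := eij (hpw i) (hpw j); case: (ltngtP i j) => [lt e|lt e|/val_inj e].
  - by exists i, j.
  - by exists j, i.
  by rewrite e eqxx in neij.
have uK (x : biburnside G G) : bmul (bmul x u) (bop u) = x.
  by rewrite -bmulA hu.2 bmulr1.
have [x xu] : exists x, bmul x u = bid G.
  elim: i j ltij eij => [|i IHi] [|j]//= ltij e; first by exists (pw j).
  by apply: (IHi j) => //; rewrite -[pw i]uK e uK.
by rewrite -{1}[bop u]bmul1 -{1}xu uK.
Qed.

(** * Twisting a Burnside ring by a homomorphism *)

Section Twist.
Variables (G H : finGroupType) (phi : {morphism [set: H] >-> G}).

Section Action.
Variables (T : Type) (a : lact G T).

(** The biset X x G, on which H acts through phi on the right of G; for X = G/R
    and phi bijective it is the coset space of Delta(R, phi, phi^-1(R)). *)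
Definition twist_fun (gh : G * H) (z : T * G) : T * G :=
  (a gh.1 z.1, gh.1 * z.2 * (phi gh.2)^-1)%g.

Fact twist_is_lact : is_lact twist_fun.
Proof.
split=> [[x k]|[g h] [g' h'] [x k]]; rewrite /twist_fun /=.
  by rewrite lact1 morph1 invg1 mulg1 mul1g.
by rewrite lactM morphM ?inE// invMg !mulgA.
Qed.
Definition twist_lact := Lact twist_is_lact.
End Action.

Definition gclass_twist (x : gclass G) : gclass (G * H)%type :=
  cls (twist_lact (gact (repr x))).

Lemma gclass_twistE (T : finType) (a : lact G T) :
  gclass_twist (cls a) = cls (twist_lact a).
Proof.
apply/clsP; have [f [[f' fK f'K] fE]] := cls_gact a.
exists (fun z => (f z.1, z.2)); split.
  by exists (fun z => (f' z.1, z.2)) => -[x k]; rewrite /= ?fK ?f'K.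
by move=> gh [x k]; rewrite /= /twist_fun /= fE.
Qed.

Fact gcl_twistD : {morph (fun x => gcl (gclass_twist x)) : x y / x + y}.
Proof.
move=> x y; rewrite (cls_repr x) (cls_repr y) -clsD !gclass_twistE -gclD -clsD.
congr gcl; apply/clsP.
exists (fun z => match z.1 with inl s => inl (s, z.2) | inr s => inr (s, z.2) end).
split; last by move=> gh [[]].
by exists (fun z => match z with inl s => (inl s.1, s.2)
  | inr s => (inr s.1, s.2) end) => [[[]]|[[]|[]]].
Qed.

Definition twist : burnside G -> biburnside G H :=
  gext (fun x => gcl (gclass_twist x)).

Lemma twist_cl (T : finType) (a : lact G T) :
  twist (gcl (cls a)) = gcl (cls (twist_lact a)).
Proof. by rewrite /twist (gext_cl gcl_twistD) gclass_twistE. Qed.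

Lemma twistD : {morph twist : u v / u + v}.
Proof. exact: gextD gcl_twistD. Qed.
Lemma twistB : {morph twist : u v / u - v}.
Proof. by move=> u v; rewrite twistD (morphN twistD). Qed.
HB.instance Definition _ :=
  GRing.isZmodMorphism.Build (burnside G) (biburnside G H) twist twistB.

Lemma twist_Bdelta u : injective phi -> twist u \in Bdelta G H.
Proof.
move=> phi_inj; rewrite (grothE u) twistB.
rewrite (cls_repr (repr u).1) (cls_repr (repr u).2) !twist_cl.
have free T (a : lact G T) : bifree (twist_lact a).
  split=> [g [x k] []|[x k] h []]; rewrite /lmul /rmul /=.
    by rewrite morph1 invg1 mulg1 => _ /(canRL (mulgK k)); rewrite mulgV.
  rewrite mul1g => _ /(canRL (mulKg k)); rewrite mulVg => /eqP.
  by rewrite invg_eq1 -(morph1 phi) => /eqP/phi_inj/eqP; rewrite invg_eq1 => /eqP.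
by apply: rpredB; apply: Bdelta_cls; apply: free.
Qed.

Lemma mark_twist (S : finGroupType) (alpha : S -> G) (beta : S -> H) u :
  mark (graph alpha beta) (twist u) = mark (alpha @: [set: S])%SET u *
    #|[set k | [forall s, alpha s * k == k * phi (beta s)]%g]|%:Z.
Proof.
move: u; apply: groth_ext => [u v|u v|x].
- by rewrite twistD markD.
- by rewrite markD mulrDl.
rewrite (cls_repr x); move: (gact _) => a.
rewrite twist_cl !mark_cl -PoszM -cardsX; congr Posz.
apply: eq_card => -[y k]; rewrite in_setX [k \in _]inE.
apply/graph_fixP/andP => [h|[/fixptsP h /forallP h'] s].
  split; [apply/fixptsP => _ /imsetP[s _ ->]|apply/forallP => s];
  have := h s; rewrite /lmul /rmul /= /twist_fun /= => -[].
    by rewrite lact1.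
  by move=> _; rewrite morph1 invg1 mulg1 mul1g morphV ?inE// invgK => /eqP.
rewrite /lmul /rmul /= /twist_fun /= h ?imset_f// lact1 morph1 invg1 mulg1 mul1g.
by rewrite morphV ?inE// invgK (eqP (h' s)).
Qed.
End Twist.

Section TwistTheory.
Variables G H K : finGroupType.
Variables (phi : {morphism [set: H] >-> G}).

(** In (X x G) tensor_H (Y x H) the element (x, k) tensor (y, l) can be moved,
    when the action of H on Y extends to G through phi, to
    (x, k y, k phi(l)). *)
Lemma twist_bmul (psi : {morphism [set: K] >-> H})
    (chi : {morphism [set: K] >-> G}) u w : (forall k, chi k = phi (psi k)) ->
  bmul (twist phi u) (twist psi (burnside_res phi w)) = twist chi (u * w).
Proof.
move=> chiE; move: u; apply: groth_ext => [u v|u v|x].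
- by rewrite twistD bmulDl.
- by rewrite mulrDl twistD.
move: w; apply: groth_ext => [u v|u v|y].
- by rewrite burnside_resD twistD bmulDr.
- by rewrite mulrDr twistD.
rewrite (cls_repr x) (cls_repr y); move: (gact (repr x)) (gact (repr y)) => a b.
rewrite burnside_res_cl gclass_resE -gclM -clsM !twist_cl bmul_cl.
congr gcl; apply/clsP.
pose q (z : gset_carrier (repr x) * G) t := ((z.1, b z.2 t.1), z.2 * phi t.2)%g.
apply: (@tensor_iso _ _ _ _ _ _ _ _ _ q).
- move=> [[s t] g]; exists (s, g), (b g^-1%g t, 1%g).
  by rewrite /q /= lactKV morph1 mulg1.
- move=> [s g] [t h] [s' g'] [t' h']; rewrite tens_eq /q /=; split.
    case=> -> et eg; exists (h * h'^-1)%g.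
    have eg' : g' = (g * phi (h * h'^-1))%g.
      by rewrite morphM ?morphV ?inE// mulgA eg mulgK.
    rewrite /rmul /lmul /= /twist_fun /= lact1 !morph1 !invg1 !mulg1 mul1g.
    rewrite invgK mulgKV eg' mulgK; split=> //; congr (_, _).
    by apply: (@lact_inj _ _ b g); rewrite et eg' lactM.
  case=> k; rewrite /rmul /lmul /= /twist_fun /= lact1 !morph1 !invg1 !mulg1.
  rewrite mul1g invgK => -[[-> ->] [-> ->]].
  by rewrite -lactM mulgKV morphM ?inE// mulgA mulgKV.
move=> g k [s g'] [t h]; rewrite /q /= /lmul /rmul /= /twist_fun /prod_fun /=.
rewrite !morph1 !invg1 !mulg1 lact1 !invgK mul1g lactM morphM ?inE//.
by rewrite morphV ?inE// chiE !mulgA.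
Qed.

Lemma twist_bop (phi' : {morphism [set: G] >-> H}) u :
    cancel phi phi' -> cancel phi' phi ->
  bop (twist phi u) = twist phi' (burnside_res phi u).
Proof.
move=> phiK phi'K; move: u; apply: groth_ext => [u v|u v|x].
- by rewrite twistD bopD.
- by rewrite burnside_resD twistD.
rewrite (cls_repr x) twist_cl bop_cl burnside_res_cl gclass_resE twist_cl.
move: (gact _) => a; congr gcl; apply/clsP.
exists (fun z => (a z.2^-1%g z.1, (phi' z.2)^-1%g)); split.
  exists (fun z => (a (phi z.2)^-1%g z.1, (phi z.2)^-1%g)) => -[t g] /=.
    by rewrite morphV ?inE// phi'K invgK -lactM mulgV lact1.
  by rewrite invgK lactKV morphV ?inE// phiK invgK.
move=> [h g] [t k]; rewrite /= /twist_fun /=; congr (_, _).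
  by rewrite -!lactM !invMg invgK -!mulgA mulVg mulg1.
by rewrite !morphM ?morphV ?morphM ?inE// phiK !invMg invgK mulgA.
Qed.

Lemma twist_conj (phi' : {morphism [set: H] >-> G}) c u :
  (forall h, phi' h = phi h ^ c)%g -> twist phi' u = twist phi u.
Proof.
move=> e; move: u; apply: groth_ext; try exact: twistD.
move=> x; rewrite (cls_repr x) !twist_cl; congr gcl; apply/clsP.
exists (fun z => (z.1, z.2 * c^-1)%g); split.
  by exists (fun z => (z.1, z.2 * c)%g) => -[t g] /=; rewrite ?mulgKV ?mulgK.
move=> [g h] [t k]; rewrite /= /twist_fun /=; congr (_, _).
by rewrite e -conjVg conjgE !mulgA mulgK.
Qed.
End TwistTheory.

Lemma twist_id1 (G : finGroupType) : twist (idm [set: G]) 1 = bid G.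
Proof.
rewrite twist_cl; congr gcl; apply/clsP; exists snd; split=> //.
by exists (fun g => (tt, g)) => // -[[]].
Qed.

Lemma isom_inverse (G H : finGroupType) (phi : {morphism [set: H] >-> G}) :
    isom [set: H] [set: G] phi ->
  exists phi' : {morphism [set: G] >-> H}, cancel phi phi' /\ cancel phi' phi.
Proof.
case/isomP=> phi_inj im; have f'M :
    {in [set: G] &, {morph invm phi_inj : g k / (g * k)%g}}.
  by move=> g k _ _; rewrite morphM ?im ?inE.
exists (Morphism f'M); split=> [h|g] /=; first by rewrite invmE ?inE.
by rewrite invmK ?im ?inE.
Qed.

Lemma isom_cancel (G H : finGroupType) (phi : {morphism [set: H] >-> G})
    (phi' : G -> H) :
  cancel phi phi' -> cancel phi' phi -> isom [set: H] [set: G] phi.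
Proof.
move=> phiK phi'K; apply/isomP; split.
  by apply/injmP => h k _ _; apply: can_inj phiK _ _.
by apply/setP => g; rewrite inE -[g]phi'K mem_morphim ?inE.
Qed.

Fact tdiag_sub_group_set (G H : finGroupType) (phi : {morphism [set: H] >-> G})
  (V : {group H}) : group_set (tdiag phi V).
Proof. exact: tdiag_group_set (restrm_morphism (subsetT V) phi). Qed.
Definition tdiag_group (G H : finGroupType) (phi : {morphism [set: H] >-> G})
  (V : {group H}) : {group G * H} := Group (tdiag_sub_group_set phi V).

Lemma twist_coset (G H : finGroupType) (phi : {morphism [set: H] >-> G})
    (V : {group H}) : isom [set: H] [set: G] phi ->
  twist phi (coset_elt (phi @* V)%g) = bcoset (tdiag phi V).
Proof.
move=> /[dup] /isom_inverse[phi' [phiK phi'K]] /isomP[phi_inj im].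
rewrite -[tdiag phi V]/(gval (tdiag_group phi V)) twist_cl; congr gcl.
have iV : (1 *: (phi @* V))%g \in lcosets (phi @* V)%g [set: G].
  by apply/lcosetsP; exists 1%g; rewrite ?inE.
apply: (@cls_coset _ _ _ (twist_lact phi (coset_lact (phi @* V)%g))
  (Sub (1 *: (phi @* V))%g iV, 1%g)).
  move=> [[A iA] k]; have /lcosetsP[g _ e] := iA; exists (g, phi' (k^-1 * g)%g).
  rewrite /= /twist_fun /= phi'K mulg1 invMg invgK mulKVg; congr (_, _).
  by apply: val_inj; rewrite /= lcoset1.
move=> [g h]; rewrite /= /twist_fun /= mulg1; split.
  case=> eA /eqP; rewrite -eq_mulgV1 => /eqP eg; apply/imsetP; exists h; rewrite ?eg//.
  have : phi h \in (phi @* V)%g.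
    move/(congr1 (fun A : {set G} => g \in A)): eA.
    by rewrite lcoset1 mem_lcoset mulVg group1 -eg => /esym.
  by rewrite morphimE setTI => /imsetP[k kV /(can_inj phiK)->].
case/imsetP=> k kV [-> ->]; congr (_, _); last exact: mulgV.
have fk : phi k \in (phi @* V)%g by rewrite mem_morphim ?inE.
by apply: val_inj; rewrite /= lcoset1 (lcoset_id fk).
Qed.

(** * Isomorphisms occurring in an orthogonal element *)

Section HalfOrthIso.
Variables (G H : finGroupType) (u : biburnside G H).
Hypothesis hu : half_orth u.

Let one_hom (S K : finGroupType) : {morph (fun _ : S => 1%g : K) : s t / (s * t)%g}.
Proof. by move=> s t; rewrite mulg1. Qed.

(** The trivial homomorphisms have all of G and all of H as centralizers. *)
Lemma half_orth_card : #|G| = #|H|.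
Proof.
have c1 (K : finGroupType) : #|centralizer (fun _ : G => 1%g : K)| = #|K|.
  rewrite -cardsT; apply: eq_card => k; rewrite in_setT.
  by apply/centralizerP => s; rewrite mulg1 mul1g.
have [b bh mb] := mark_neq0_ex hu.1 hu.2 (@one_hom G G).
have b1 : b = (fun=> 1%g) :> (G -> H).
  apply/funext => s; apply/eqP.
  have /= <- := mark_Bdelta_free hu.1 mb (imset_f _ (isT : s \in G)).
  exact: eqxx.
rewrite b1 in mb; have [] := half_orth_row hu (@one_hom _ _) (@one_hom _ _) mb.
by rewrite !c1.
Qed.

Lemma half_orth_iso : exists phi : {morphism [set: G] >-> H},
  isom [set: G] [set: H] phi /\ mark (graph id phi) u != 0.
Proof.
have [b /homsP bM mb] := @mark_neq0_ex _ _ _ hu.1 hu.2 G id (fun _ _ => erefl).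
have bM' : {in [set: G] &, {morph b : s t / (s * t)%g}} by move=> s t _ _.
exists (Morphism bM'); split=> //.
have b_inj : ('injm (Morphism bM'))%g.
  apply/subsetP => g /[!inE] /= b1.
  by have /= -> := mark_Bdelta_free hu.1 mb (imset_f _ (isT : g \in G)).
apply/isomP; split=> //; apply/eqP.
by rewrite eqEcard subsetT card_injm// !cardsT half_orth_card leqnn.
Qed.
End HalfOrthIso.

Lemma half_orth_twist (G H : finGroupType) (phi : {morphism [set: H] >-> G}) v :
  isom [set: H] [set: G] phi -> v * v = 1 -> half_orth (twist phi v).
Proof.
move=> /isom_inverse[phi' [phiK phi'K]] vv; split.
  exact/twist_Bdelta/can_inj/phiK.
rewrite (twist_bop _ phiK phi'K) (@twist_bmul _ _ _ _ _ (idm [set: G])).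
  by rewrite vv twist_id1.
by move=> g; rewrite phi'K.
Qed.

Section HalfOrthBorth.
Variables (G H : finGroupType) (u : biburnside G H).

(** An isomorphism between G and H turns u into an element of B^Delta(G, G), to
    which the finiteness argument applies. *)
Lemma half_orth_bop : half_orth u -> bmul (bop u) u = bid H.
Proof.
move=> hu; have [phi [phi_iso _]] := half_orth_iso hu.
have [phi' [phiK phi'K]] := isom_inverse phi_iso.
have hD : half_orth (twist phi 1) by apply: half_orth_twist; rewrite ?mulr1.
have := half_orth_inv (half_orthM hu hD); rewrite bopM.
move/(congr1 (fun x => bmul (twist phi 1) (bmul x (bop (twist phi 1))))).
rewrite bmul1 hD.2 -!bmulA hD.2 bmulr1 !bmulA hD.2 bmul1.
by [].
Qed.

Lemma BorthP : u \in Borth G H <-> half_orth u.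
Proof.
split=> [/and3P[uB /eqP uu _] //|hu]; apply/and3P.
by rewrite hu.1 hu.2 half_orth_bop.
Qed.

Lemma half_orth_op : half_orth u -> half_orth (bop u).
Proof. by move=> hu; split; [apply/bop_Bdelta/hu.1 | rewrite bopK half_orth_bop]. Qed.
End HalfOrthBorth.

Lemma tdiag_full (G H : finGroupType) (phi : H -> G) :
  tdiag phi [set: H] = graph phi id.
Proof.
by apply/setP => p; apply/imsetP/imsetP => -[h _ ->]; exists h; rewrite ?inE.
Qed.

Lemma td_acts (G H : finGroupType) :
  [acts [set: G * H], on [set L : {group G * H} | `[< twisted_diagonal L >]]
   | 'JG].
Proof.
apply/subsetP => x _; rewrite !inE; apply/subsetP => L; rewrite !inE.
by move=> /asboolP Lt; apply/asboolP/twisted_diagonal_conj.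
Qed.

Section Occurs.
Variables (G H : finGroupType) (u : biburnside G H).
Hypothesis uB : u \in Bdelta G H.
Variable phi : {morphism [set: H] >-> G}.

Let D : {group G * H} := Group (tdiag_group_set phi).

(** No twisted diagonal subgroup is larger than one defined on all of H. *)
Lemma tdiag_full_conj L : L \in td_reps G H -> mark D (bcoset (gval L)) != 0 ->
  exists x, D = (L :^ x)%G.
Proof.
move=> Lt /mark_coset_elt_neq0[x DL]; exists x; apply: val_inj => /=.
apply/eqP; rewrite eqEcard DL cardJg.
have [_ /subsetP/(_ L Lt) + _ _] := orbit_transversalP (td_acts G H).
rewrite inE => /asboolP[R [S [alpha [_ ->]]]].
apply: leq_trans (leq_imset_card _ _) _; rewrite card_imset ?max_card//.
  by rewrite cardsT max_card.
by move=> h k [].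
Qed.

(** By maximality of the order, the only standard basis element with a non-zero
    mark at the graph of phi is the coset space of its own class. *)
Lemma occurs_mark :
  occurs (bcoset (tdiag phi [set: H])) u <-> mark (tdiag phi [set: H]) u != 0.
Proof.
rewrite -[tdiag _ _]/(gval D); split.
  case=> c [uc [L Lt [eL cL]]].
  have DL : mark D (bcoset (gval L)) != 0.
    by rewrite -eL gt_eqF ?mark_coset_elt_gt0.
  have [x Dx] := tdiag_full_conj Lt DL.
  rewrite uc raddf_sum (bigD1 L)//= raddfMz big1 ?addr0 => [|M /andP[Mt neM]].
    by rewrite -mulrzr mulf_neq0// intr_eq0.
  rewrite raddfMz; apply/eqP; rewrite -mulrzr mulf_eq0; apply/orP; left.
  apply: contraNT neM => /(tdiag_full_conj Mt)[y Dy].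
  have [_ _ tr _] := orbit_transversalP (td_acts G H).
  rewrite -(tr _ _ Mt Lt); apply/orbitP; exists (y * x^-1)%g; rewrite ?inE//.
  by apply: val_inj; rewrite /= conjsgM -[(M :^ y)%g]/(gval (M :^ y)%G) -Dy Dx conjsgK.
have [c uc] := Bdelta_zspan uB.
move=> mD; exists c; split=> //.
have [|/exists_inPn h] := boolP [exists L in td_reps G H,
    (mark D (bcoset (gval L)) != 0) && (c L != 0)].
  case/exists_inP=> L Lt /andP[mL cL]; exists L => //; split=> //.
  by have [x ->] := tdiag_full_conj Lt mL; rewrite /bcoset coset_elt_conj.
case/eqP: mD; rewrite uc raddf_sum big1//= => L /h.
rewrite raddfMz /= negb_and !negbK => /orP[/eqP->|/eqP->]; first by rewrite mul0rz.
by rewrite mulr0z.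
Qed.
End Occurs.

Lemma orth_occurs_iso (G H : finGroupType) (u : biburnside G H) : half_orth u ->
  exists phi : {morphism [set: H] >-> G},
    isom [set: H] [set: G] phi /\ mark (graph phi id) u != 0.
Proof.
move=> hu; have [phi [phi_iso mphi]] := half_orth_iso (half_orth_op hu).
by exists phi; rewrite mark_bop in mphi.
Qed.

Lemma half_orth_col (S G H : finGroupType) (u : biburnside G H) (alpha : S -> G)
    (beta : S -> H) :
    half_orth u -> {morph alpha : s t / (s * t)%g} ->
    {morph beta : s t / (s * t)%g} -> mark (graph alpha beta) u != 0 ->
  `|mark (graph alpha beta) u| = #|centralizer alpha|%:Z /\
  forall alpha' : S -> G, {morph alpha' : s t / (s * t)%g} ->
    mark (graph alpha' beta) u != 0 ->
  exists g, forall s, alpha' s = (alpha s ^ g)%g.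
Proof.
move=> hu aM bM; rewrite -mark_bop => mn.
have [<- -> h] := half_orth_row (half_orth_op hu) bM aM mn.
by split=> // alpha' a'M; rewrite -mark_bop; apply: h.
Qed.

(** * Restriction to subgroups and uniformity *)

(** Normalizers grow in a nilpotent group; take the preimage in the normalizer
    of S of a subgroup of prime order. *)
Lemma nilpotent_prime_over (H : finGroupType) (S : {group H}) :
    nilpotent [set: H] -> S \proper [set: H] ->
  exists Q : {group H}, [/\ S \subset Q, Q \subset 'N(S)%g & prime #|Q : S|%g].
Proof.
move=> nH /(nilpotent_proper_norm nH); rewrite setTI => SN.
have N1 : (1 < #|'N(S) / S|)%g%N.
  by rewrite card_quotient ?normG// indexg_gt1 proper_subn.
have [x xN ox] := Cauchy (pdiv_prime N1) (pdiv_dvd _).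
exists (coset S @*^-1 <[x]>)%G; split; first exact: sub_cosetpre.
  by rewrite subsetIl.
have := card_cosetpre <[x]>%G; rewrite -(Lagrange (sub_cosetpre <[x]>%G)).
by move/eqP; rewrite eqn_pmul2l ?cardG_gt0// => /eqP->; rewrite [#|_|]ox pdiv_prime.
Qed.

Section PrimeExtension.
Variables (G H : finGroupType) (phi : {morphism [set: H] >-> G}).
Variables S Q : {group H}.
Hypotheses (SQ : S \subset Q) (QNS : Q \subset 'N(S)%g).

Let phiS (s : subg_of S) : G := phi (sgval s).
Let C := centralizer phiS.

(** The extensions to Q of the restriction of phi to S. *)
Definition hom_exts : {set {ffun subg_of Q -> G}} :=
  [set tau in homs (subg_of Q) G |
    [forall q : subg_of Q, (sgval q \in S) ==> (tau q == phi (sgval q))]].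

Let CP c : reflect (forall s, s \in S -> phi s * c = c * phi s)%g (c \in C).
Proof.
apply: (iffP (centralizerP _ _)) => h s; last exact/h/subgP.
by move=> sS; have := h (subg S s); rewrite /phiS subgK.
Qed.

Let SJ s q : s \in S -> q \in Q -> (s ^ q)%g \in S.
Proof. by move=> sS qQ; rewrite memJ_norm// (subsetP QNS). Qed.

Let CJ c q : c \in C -> q \in Q -> (c ^ phi q)%g \in C.
Proof.
move=> /CP cC qQ; apply/CP => s sS.
have -> : phi s = (phi (s ^ q^-1)%g ^ phi q)%g by rewrite -morphJ ?inE// conjgKV.
by rewrite -!conjMg cC// SJ ?groupV.
Qed.

(** The extension of Q by C formed by the pairs (c phi(q), q), which acts on the
    points fixed by the graph of phi on S. *)
Definition ext_set : {set G * H} := [set (w.1 * phi w.2, w.2)%g | w in setX C Q].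

Lemma ext_setP g h :
  reflect (h \in Q /\ (g * (phi h)^-1)%g \in C) ((g, h) \in ext_set).
Proof.
apply: (iffP imsetP) => [[[c q] /setXP[/= cC qQ] [-> ->]]|[hQ gC]].
  by rewrite mulgK.
by exists (g * (phi h)^-1, h)%g; rewrite ?in_setX /= ?mulgKV// hQ gC.
Qed.

Fact ext_group_set : group_set ext_set.
Proof.
apply/group_setP; split.
  by apply/ext_setP; rewrite morph1 invg1 mulg1 !group1.
move=> _ _ /imsetP[[c q] /setXP[/= cC qQ] ->] /imsetP[[d r] /setXP[/= dC rQ] ->].
apply/ext_setP; split; first exact: groupM.
have -> : (c * phi q * (d * phi r) * (phi (q * r))^-1 = c * d ^ phi q^-1)%g.
  by rewrite !morphM ?morphV ?inE// conjgE invgK invMg !mulgA mulgK.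
by rewrite groupM// CJ ?groupV.
Qed.
Definition ext_group := Group ext_group_set.

Lemma card_ext_group : #|ext_group| = (#|C| * #|Q|)%N.
Proof.
rewrite -cardsX card_imset// => -[c q] [d r] /= [+ eqr].
by rewrite eqr => /mulIg->.
Qed.

Section Fixpoints.
Variables (T : finType) (a : lact (G * H)%type T).
Hypothesis af : bifree a.

Let Z := fixpts a (graph phiS sgval).

Let ZP x : reflect (forall s, s \in S -> lmul a (phi s) x = rmul a x s) (x \in Z).
Proof.
apply: (iffP (graph_fixP _ _ _ _)) => h s; last exact/h/subgP.
by move=> sS; have := h (subg S s); rewrite /phiS subgK.
Qed.

Let stab x := (ext_group :&: stabilizer a x)%g.

Let lmul_inj x g g' : lmul a g x = lmul a g' x -> g = g'.
Proof.
move=> e; apply/eqP; rewrite eq_mulVg1 -invg_eq1 invMg invgK; apply/eqP.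
by apply: (af.1 _ x); rewrite lmulM e -lmulM mulVg lmul1.
Qed.

Let stabE g h x : (a (g, h) x == x) = (lmul a g x == rmul a x h).
Proof.
rewrite bimulE /=; apply/eqP/eqP => [e|->]; last by rewrite -rmulM mulgV rmul1.
by rewrite -[in RHS]e -rmulM mulVg rmul1.
Qed.

Let stabP g h x : reflect
  [/\ h \in Q, (g * (phi h)^-1)%g \in C & lmul a g x = rmul a x h]
  ((g, h) \in stab x).
Proof.
rewrite inE [_ \in stabilizer a x]inE stabE.
by apply: (iffP andP) => [[/ext_setP[? ?] /eqP ?]|[? ? /eqP ?]]; split=> //;
  apply/ext_setP.
Qed.

Let proj x := (snd_morphism G H @* (stab x))%G.
Let projP x h : reflect (exists g, (g, h) \in stab x) (h \in proj x).
Proof.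
rewrite /= morphimEsub ?subsetT//.
by apply: (iffP imsetP) => [[[g k] gL ->]|[g gL]]; [exists g | exists (g, h)].
Qed.

Let card_proj x : #|proj x| = #|stab x|.
Proof.
rewrite /= morphimEsub ?subsetT// card_in_imset// => -[g h] [g' h'] /=.
by move=> /stabP[_ _ e] /stabP[_ _ e'] eh; rewrite -eh -e in e' *; rewrite (lmul_inj e').
Qed.

Let proj_sub x : proj x \subset Q.
Proof. by apply/subsetP => h /projP[g /stabP[]]. Qed.

Let proj_sup x : x \in Z -> S \subset proj x.
Proof.
move=> /ZP xZ; apply/subsetP => s sS; apply/projP; exists (phi s).
by apply/stabP; split; [exact: (subsetP SQ) | rewrite mulgV group1 | exact: xZ].
Qed.

Let ext_fixpts w x : w \in ext_group -> x \in Z -> a w x \in Z.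
Proof.
case: w => g h /ext_setP[hQ gC] /ZP xZ; apply/ZP => s sS.
have gs : (phi s * g = g * phi (s ^ h))%g.
  have -> : g = (g * (phi h)^-1 * phi h)%g by rewrite mulgKV.
  rewrite mulgA (CP _ gC)// -!mulgA; congr (_ * (_ * _))%g.
  by rewrite morphJ ?inE// conjgE !mulgA mulgV mul1g.
rewrite bimulE /= lrmulC -lmulM gs lmulM xZ ?SJ// lrmulC -!rmulM.
by rewrite conjgE !mulgA mulgK.
Qed.

Let ext_stab w x : w \in ext_group -> #|stab (a w x)| = #|stab x|.
Proof.
move=> wW; rewrite -(cardJg (stab x) w^-1); apply: eq_card => v.
rewrite mem_conjgV !in_setI groupJr//; congr (_ && _).
rewrite [LHS]inE [RHS]inE.
by rewrite -(inj_eq (@lact_inj _ _ a w^-1%g)) lactK conjgE !lactM.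
Qed.

Hypothesis prime_index : prime #|Q : S|%g.

Let card_stab x : x \in Z -> (#|stab x| == #|S|) || (#|stab x| == #|Q|).
Proof.
move=> xZ; have SP := proj_sup xZ; have PQ := proj_sub x.
have := Lagrange_index PQ SP => iE.
have := primeP prime_index => -[_ /(_ #|proj x : S|%g)].
rewrite -iE dvdn_mull// => /(_ isT)/orP[/eqP i1|/eqP iQ].
  by rewrite -card_proj -(Lagrange SP) i1 muln1 eqxx.
by rewrite -card_proj -(Lagrange SP) iQ iE (Lagrange SQ) eqxx orbT.
Qed.

Let Z2 := [set x in Z | #|stab x| == #|Q|].

Let proj_full x : x \in Z2 -> proj x = Q.
Proof.
rewrite inE => /andP[_ /eqP e]; apply/val_inj/eqP.
by rewrite eqEcard (proj_sub x) card_proj e leqnn.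
Qed.

Let ext_fix tau x :
  tau \in hom_exts -> x \in fixpts a (graph tau sgval) -> x \in Z2.
Proof.
rewrite inE => /andP[/homsP tauM /forallP tauS] /graph_fixP tx.
have tauM' : {in [set: subg_of Q] &, {morph tau : s t / (s * t)%g}}.
  by move=> s t _ _; apply: tauM.
pose t := Morphism tauM'.
have tauE s : s \in S -> t (subg Q s) = phi s.
  move=> sS; have := tauS (subg Q s); rewrite subgK ?(subsetP SQ)// sS /=.
  by move/eqP.
have xZ : x \in Z.
  apply/ZP => s sS; rewrite -tauE// tx subgK//.
  exact: (subsetP SQ).
rewrite inE xZ -card_proj; apply/eqP/eq_card => q; apply/idP/idP.
  exact: (subsetP (proj_sub x)).
move=> qQ; apply/projP; exists (t (subg Q q)); apply/stabP; split=> //; last first.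
  by rewrite tx subgK.
(* Two extensions of phi from S to Q differ by elements centralizing phi(S),
   as S is normal in Q. *)
apply/CP => s sS; have := tauE _ (SJ sS qQ).
have -> : subg Q (s ^ q)%g = (subg Q s ^ subg Q q)%g.
  by apply: (morphJ (subg_morphism Q)); rewrite ?(subsetP SQ s).
rewrite (morphJ t) ?inE// (tauE s)// morphJ ?inE// => e.
have := congr1 (fun y => t (subg Q q) * y * (phi q)^-1)%g e.
rewrite /= !conjgE !mulgA mulgV mul1g mulgK => <-.
by rewrite -!mulgA.
Qed.

Let sum_card_ext_fix :
  \sum_(tau in hom_exts) #|fixpts a (graph tau sgval)|%:Z = #|Z2|%:Z.
Proof.
under eq_bigr => tau _ do rewrite -[Posz _]natz.
rewrite -natr_sum natz; congr Posz.
transitivity (\sum_(x : T) \sum_(tau in hom_exts |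
    x \in fixpts a (graph tau sgval)) 1)%N.
  rewrite (exchange_big_dep (mem hom_exts)) => [|x tau _ /andP[]//] /=.
  apply: eq_bigr => tau /= th; rewrite sum1dep_card; apply: eq_card => x.
  by rewrite [RHS]in_set th.
rewrite -[RHS]sum1_card [RHS]big_mkcond; apply: eq_bigr => x _; rewrite sum1dep_card.
case: ifP => [xZ2|/negP xZ2]; last first.
  apply/eqP; rewrite cards_eq0; apply/eqP/setP => tau; rewrite in_set in_set0.
  by apply/negP => /andP[/ext_fix tx /tx].
have ex (q : subg_of Q) : exists g, (g, sgval q) \in stab x.
  by apply/projP; rewrite proj_full// subgP.
pose tau : {ffun subg_of Q -> G} := [ffun q => xchoose (ex q)].
have tauE q : lmul a (tau q) x = rmul a x (sgval q).
  by rewrite ffunE; have /stabP[] := xchooseP (ex q).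
suff -> : [set t in hom_exts | x \in fixpts a (graph t sgval)] = [set tau].
  by rewrite cards1.
apply/setP => t; rewrite in_set in_set1; apply/andP/eqP => [[_ /graph_fixP h]|->].
  by apply/ffunP => q; apply: (@lmul_inj x); rewrite h tauE.
split; last by apply/graph_fixP.
rewrite inE; apply/andP; split.
  apply/homsP => q r; apply: (@lmul_inj x).
  by rewrite tauE lmulM tauE lrmulC tauE -rmulM.
apply/forallP => q; apply/implyP => qS; apply/eqP/(@lmul_inj x).
by move: xZ2; rewrite inE tauE => /andP[/ZP-> //].
Qed.

(** By freeness the stabilizer in the extension of Q by C of a fixed point
    projects isomorphically to a group between S and Q, hence to S or to Q. In
    the first case the orbit has p |C| elements; in the second case the
    stabilizer is the graph of an extension of phi to Q. *)
Lemma card_fix_congr :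
  ((#|Q : S|%g * #|C|)%N%:Z %| #|Z|%:Z -
    \sum_(tau in hom_exts) #|fixpts a (graph tau sgval)|%:Z)%Z.
Proof.
rewrite sum_card_ext_fix.
pose Z1 := [set x in Z | #|stab x| == #|S|].
have ZE : #|Z| = (#|Z1| + #|Z2|)%N.
  rewrite -(cardsID Z2) addnC (setIidPr _); last by apply/subsetP => x /[!inE] /andP[].
  congr addn; apply: eq_card => x; rewrite !in_setD ![_ \in [set _ in _ | _]]inE.
  case xZ: (x \in Z) => //=.
  have := card_stab xZ; have ltSQ : (#|S| < #|Q|)%N.
    by rewrite -(Lagrange SQ) ltn_Pmulr ?cardG_gt0// prime_gt1.
  by case: eqP => [->|_ /eqP->] //=; rewrite ?eqxx ?(ltn_eqF ltSQ).
rewrite ZE PoszD addrK dvdzE /=.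
have := @card_stabilizer_dvd _ _ a ext_group Z1 #|S|.
rewrite card_ext_group -(Lagrange SQ) mulnCA mulnC dvdn_pmul2r ?cardG_gt0//.
rewrite mulnC; apply => [w x wW|x]; last by rewrite inE => /andP[_ /eqP].
by rewrite ![_ \in Z1]inE => /andP[xZ e]; rewrite ext_fixpts// ext_stab.
Qed.
End Fixpoints.

Hypothesis prime_index : prime #|Q : S|%g.

Lemma mark_ext_congr u : u \in Bdelta G H ->
  ((#|Q : S|%g * #|C|)%N%:Z %| mark (graph phiS sgval) u -
    \sum_(tau in hom_exts) mark (graph tau sgval) u)%Z.
Proof.
move: u; apply: Bdelta_ind => [T a af|u v uE vE].
  have -> : \sum_(tau in hom_exts) mark (graph tau sgval) (gcl (cls a)) =
      \sum_(tau in hom_exts) #|fixpts a (graph tau sgval)|%:Z.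
    by apply: eq_bigr => tau _; apply: mark_cl.
  by rewrite mark_cl; apply: card_fix_congr.
have -> : \sum_(tau in hom_exts) mark (graph tau sgval) (u - v) =
    \sum_(tau in hom_exts) mark (graph tau sgval) u -
    \sum_(tau in hom_exts) mark (graph tau sgval) v.
  by rewrite -sumrB; apply: eq_bigr => tau _; apply: markB.
by rewrite markB opprD addrACA -opprD; apply: rpredB.
Qed.

Let phiQ (q : subg_of Q) : G := phi (sgval q).
Let CQ := centralizer phiQ.

(** Extensions of phi from S to Q with a non-zero mark are conjugate to phi on Q,
    necessarily by elements of C. There are |C : C_Q| of them, with C_Q the
    centralizer of phi(Q), and each has the same mark, |C_Q| up to sign; their
    sum is |C| up to sign, which p |C| does not divide. *)
Lemma mark_restrict_neq0 u : half_orth u ->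
  mark (graph phiQ sgval) u != 0 -> mark (graph phiS sgval) u != 0.
Proof.
move=> hu mQ; have phiM (P : {group H}) :
    {morph (fun s : subg_of P => phi (sgval s)) : s t / (s * t)%g}.
  by move=> s t; rewrite /= morphM ?inE.
have [mQE col] := half_orth_col hu (phiM Q) (fun _ _ => erefl) mQ.
pose conj g : {ffun subg_of Q -> G} := [ffun q => phiQ q ^ g]%g.
pose E := [set tau in hom_exts | mark (graph tau sgval) u != 0].
have CQC : CQ \subset C.
  apply/subsetP => g /centralizerP h; apply/CP => s sS.
  by have := h (subg Q s); rewrite /phiQ subgK ?(subsetP SQ).
have tauS tau q : tau \in hom_exts -> sgval q \in S -> tau q = phi (sgval q).
  by rewrite inE => /andP[_ /forallP/(_ q)/implyP h] /h/eqP.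
have conj_fun g : conj g = (fun q => phiQ q ^ g)%g :> (subg_of Q -> G).
  by apply/funext => q; rewrite ffunE.
have conjE g : g \in C -> conj g \in E.
  move=> /CP gC; rewrite inE conj_fun mark_graph_conjl mQ andbT inE.
  apply/andP; split.
    by apply/homsP => q r; rewrite !ffunE -conjMg; congr (_ ^ _)%g; apply: phiM.
  apply/forallP => q; apply/implyP => qS; rewrite ffunE conjgE.
  by rewrite /phiQ gC// mulKg.
have Econj tau : tau \in E -> exists2 g, g \in C & tau = conj g.
  rewrite inE => /andP[th mt]; have tM : {morph tau : q r / (q * r)%g}.
    by apply/homsP; move: th; rewrite inE => /andP[].
  have [g e] := col tau tM mt; exists g; last first.
    by apply/ffunP => q; rewrite e ffunE.
  apply/CP => s sS; have sQ := subsetP SQ s sS.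
  have := e (subg Q s); rewrite /phiQ tauS// ?subgK// => es.
  by rewrite conjgC -es.
have cardC : #|C| = (#|E| * #|CQ|)%N.
  rewrite -sum1_card (partition_big conj (mem E)) => [|g /conjE//] /=.
  rewrite -sum_nat_const; apply: eq_bigr => tau /Econj[g gC ->].
  rewrite sum1dep_card -(card_rcoset CQ g); apply: eq_card => k.
  rewrite [LHS]inE mem_rcoset; apply/andP/centralizerP => [[kC /eqP/ffunP e] q|h].
    apply/commgP/conjg_fixP; rewrite conjgM.
    by have := e q; rewrite !ffunE => ->; rewrite -conjgM mulgV conjg1.
  split; first by rewrite -[k](mulgKV g) groupM// (subsetP CQC)//; apply/centralizerP.
  apply/eqP/ffunP => q; rewrite !ffunE -[k in LHS](mulgKV g) conjgM.
  by congr (_ ^ _)%g; apply/conjg_fixP/commgP/h.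
have sumE : \sum_(tau in hom_exts) mark (graph tau sgval) u =
    mark (graph phiQ sgval) u *+ #|E|.
  rewrite -sumr_const (big_setID [set tau : {ffun subg_of Q -> G} |
    mark (graph tau sgval) u != 0])/=.
  rewrite [X in _ + X]big1 ?addr0 => [|tau]; last first.
    by rewrite !inE negbK => /andP[/eqP].
  apply: eq_big => [tau|tau /setIP[th]]; first by rewrite !inE.
  rewrite inE => mt; have /Econj[g _ ->] : tau \in E by rewrite inE th.
  by rewrite conj_fun mark_graph_conjl.
apply/eqP => mS; have := mark_ext_congr hu.1.
rewrite mS sumE sub0r dvdzE abszN -mulr_natr natz abszM /=.
have -> : absz (mark (graph phiQ sgval) u) = #|CQ|.
  by apply/eqP; rewrite -eqz_nat abszE mQE.
rewrite [X in (_ %| X)%N]mulnC -cardC => /dvdn_leq; rewrite cardG_gt0 => /(_ isT).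
by rewrite leqNgt ltn_Pmull ?cardG_gt0// prime_gt1.
Qed.
End PrimeExtension.
Section NilpotentUniform.
Variables (G H : finGroupType) (u : biburnside G H).
Hypotheses (hu : half_orth u) (nilH : nilpotent [set: H]).
Variable phi : {morphism [set: H] >-> G}.
Hypothesis mphi : mark (graph phi id) u != 0.

Lemma mark_tdiag_neq0 (V : {group H}) : mark (tdiag phi V) u != 0.
Proof.
have [n] := ubnP (#|H| - #|V|); elim: n V => // n IHn V; rewrite ltnS => leV.
have [VT|] := eqVneq (gval V) [set: H]; first by rewrite VT tdiag_full.
rewrite -properT => /(nilpotent_prime_over nilH)[Q [VQ QN pQ]].
rewrite tdiag_graph; apply: (mark_restrict_neq0 VQ QN pQ hu).
rewrite -tdiag_graph; apply: IHn; apply: leq_trans leV.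
have ltV : (#|V| < #|Q|)%N by rewrite -(Lagrange VQ) ltn_Pmulr ?prime_gt1.
by rewrite ltn_sub2l// (leq_trans ltV)// max_card.
Qed.

Let F : {set {group G * H}} :=
  [set L : {group G * H} |
    `[< exists (V : {group H}) x, gval L = (tdiag phi V :^ x)%g >]].

(** Since the mark at phi on S is not zero, the column of the inclusion of S is
    supported on the class of phi, so the marks live on the conjugates of the
    twisted diagonals of restrictions of phi. *)
Lemma orth_zspan_tdiag :
  zspan setT (fun V : {group H} => bcoset (tdiag phi V)) u.
Proof.
have Fu : zspan (orbit_transversal 'JG [set: G * H] F)
    (fun L : {group G * H} => bcoset L) u.
  apply: burnside_zspan_sub => [L M|L x|L].
  - rewrite !inE => /asboolP[V [x eM]] LM; apply/asboolP.
    have LV : (L :^ x^-1)%g \subset tdiag phi V.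
      by rewrite sub_conjgV -eM.
    exists (snd_morphism G H @* (L :^ x^-1))%G, x.
    rewrite -[LHS](conjsgKV x); congr (_ :^ _)%g.
    apply/setP => p; apply/idP/imsetP => [pL|[h]].
      have /imsetP[h hV e] := subsetP LV p pL; exists h => //.
      rewrite /= morphimEsub ?subsetT//; apply/imsetP; exists p => //.
      by rewrite e.
    rewrite /= morphimEsub ?subsetT// => /imsetP[q qL ->] ->.
    by have /imsetP[k kV e] := subsetP LV q qL; rewrite e in qL *.
  - rewrite !inE => /asboolP[V [y e]]; apply/asboolP; exists V, (y * x)%g.
    by rewrite /= e conjsgM.
  rewrite inE => /asboolP FL; apply/eqP/negPn/negP => mL; apply: FL.
  have [R [S [alpha [_ eL]]]] := mark_Bdelta_tdiag hu.1 mL.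
  have := mark_tdiag_neq0 S; rewrite tdiag_graph => mS.
  have phiM : {morph (fun s : subg_of S => phi (sgval s)) : s t / (s * t)%g}.
    by move=> s t; rewrite /= morphM ?inE.
  have [_ col] := half_orth_col hu phiM (fun _ _ => erefl) mS.
  rewrite eL tdiag_graph in mL; have [g e] := col _ (sgval_hom alpha) mL.
  exists S, (g, 1%g); rewrite eL /tdiag /conjugate -imset_comp.
  apply: eq_in_imset => s sS; have := e (subg S s); rewrite subgK// => -> /=.
  by congr (_, _); rewrite -[RHS]/(s ^ 1)%g conjg1.
apply: zspan_trans Fu _ => L LX.
have act : [acts [set: G * H], on F | 'JG].
  apply/subsetP => x _; rewrite !inE; apply/subsetP => M; rewrite !inE.
  move=> /asboolP[V [y e]]; apply/asboolP; exists V, (y * x)%g.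
  by rewrite /= e conjsgM.
have [_ /subsetP/(_ L LX) + _ _] := orbit_transversalP act.
rewrite inE => /asboolP[V [x ->]].
rewrite /bcoset (coset_elt_conj (tdiag_group phi V)).
exact: (zspan_gen (fun V : {group H} => bcoset (tdiag phi V)) (in_setT V)).
Qed.
End NilpotentUniform.

(** * Orthogonal units of nilpotent groups *)

Lemma twist_inj (G H : finGroupType) (phi : {morphism [set: H] >-> G}) :
  isom [set: H] [set: G] phi -> injective (twist phi).
Proof.
move=> /isom_inverse[phi' [_ phi'K]] u v e; apply: mark_inj => L.
have := congr1 (mark (graph (@sgval G L) (phi' \o sgval))) e.
rewrite !mark_twist; have -> : (sgval @: [set: subg_of L])%SET = L.
  apply/setP => g; apply/imsetP/idP => [[s _ ->]|gL]; first exact: subgP.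
  by exists (subg L g); rewrite ?inE ?subgK.
apply/mulIf; rewrite eqz_nat -lt0n; apply/card_gt0P; exists 1%g; rewrite inE.
by apply/forallP => s; rewrite /= phi'K mulg1 mul1g.
Qed.

Lemma mark_unit_neq0 (G : finGroupType) (u : burnside G) L :
  u \is a GRing.unit -> mark L u != 0.
Proof.
move=> /unitrPr[v uv]; apply/eqP => m0.
by have := congr1 (mark L) uv; rewrite markM mark1 m0 mul0r.
Qed.

(** The marks of a unit are units of the ring of integers. *)
Lemma burnside_unit_sqr (G : finGroupType) (u : burnside G) :
  u \is a GRing.unit -> u * u = 1.
Proof.
move=> /unitrPr[v uv]; apply: mark_inj => L; rewrite markM mark1.
have /(congr1 (mark L)) := uv; rewrite markM mark1 => m1.
have /eqP := congr1 absz m1; rewrite abszM muln_eq1 => /andP[/eqP m _].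
by rewrite -expr2 -[_ ^+ 2]ger0_norm ?sqr_ge0// normrX -abszE m.
Qed.

Section SemidirectProduct.
Variable G : finGroupType.

Lemma out_morphism_isom (x : Out G) : isom [set: G] [set: G] (out_morphism x).
Proof. by apply/isomP; split; [apply: injm_autm | apply: im_autm]. Qed.

Lemma out_res_act (x : Out G) (u : burnside G) :
  burnside_res (out_morphism x) (out_act x u) = u.
Proof.
transitivity (out_act x^-1%g (out_act x u)); first by rewrite /out_act invgK.
by rewrite -out_act_comp mulgV out_act_one.
Qed.

Lemma eq_out (x y : Out G) k :
  (forall g, out_rep y g = out_rep x g ^ k)%g -> x = y.
Proof.
move=> e; apply: val_inj => /=; rewrite -!coset_out_rep.
apply/esym/rcoset_kercosetP; try exact: out_rep_norm.
have -> : out_rep y = (out_rep x * conj_aut [set: G] k)%g.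
  by apply/permP => g; rewrite permM conj_autE ?inE.
rewrite mem_rcoset -mulgA -[X in (X * _)%g]invgK -conjgE.
rewrite memJ_norm ?groupV ?out_rep_norm// mem_morphim ?in_setT//.
by rewrite (subsetP (normG _)) ?in_setT.
Qed.

Fact sd_orth_subproof (p : burnside_sdprod G) :
  twist (out_morphism p.2) (val p.1) \in Borth G G.
Proof.
apply/BorthP/half_orth_twist; first exact: out_morphism_isom.
exact/burnside_unit_sqr/(valP p.1).
Qed.
Definition sd_orth (p : burnside_sdprod G) : orth_group G :=
  Sub (twist (out_morphism p.2) (val p.1)) (sd_orth_subproof p).

(** The product in Out(G) is composition from left to right, so that y * x is the
    class of x after y. *)
Lemma sd_orthM : {morph sd_orth : p q / (p * q)%g}.
Proof.
move=> [u x] [v y]; apply: val_inj; rewrite /= -[val v in RHS](out_res_act x).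
pose f := out_morphism x \o out_morphism y.
have fM : {in [set: G] &, {morph f : g h / (g * h)%g}}.
  by move=> g h _ _; rewrite /f /= !morphM ?inE.
rewrite (@twist_bmul _ _ _ _ _ (Morphism fM))//.
have [c e] := out_morphismM y x.
exact: (@twist_conj _ _ (Morphism fM) (out_morphism (y * x)%g) c _ e).
Qed.

(** The mark of twist x u at the graph of an automorphism is not zero exactly
    when that automorphism lies in the class x, so x is determined; then so is
    u, by injectivity of twisting. *)
Lemma sd_orth_inj : injective sd_orth.
Proof.
move=> [u x] [v y] /(congr1 val) /= e.
have xy : x = y.
  have := congr1 (mark (graph (out_morphism x) id)) e; rewrite !mark_twist.
  move=> em; have : mark (out_morphism x @: [set: G])%SET (val v) *
      #|[set k | [forall s, out_morphism x s * k == k * out_morphism y s]%g]|%:Z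
      != 0.
    rewrite -em mulf_neq0//; first exact/mark_unit_neq0/(valP u).
    rewrite eqz_nat -lt0n; apply/card_gt0P; exists 1%g; rewrite inE.
    by apply/forallP => s; rewrite mulg1 mul1g.
  rewrite mulf_eq0 negb_or eqz_nat cards_eq0 => /andP[_ /set0Pn[k]].
  rewrite inE => /forallP ek; apply: (@eq_out _ _ k) => g.
  have /eqP := ek g; rewrite /= !autmE conjgE => ->.
  by rewrite mulKg.
rewrite -xy in e *; congr (_, _); apply: val_inj.
exact: twist_inj (out_morphism_isom x) _ _ e.
Qed.

Hypothesis nilG : nilpotent [set: G].

(** An orthogonal element is twist phi w by uniformity, and orthogonality says
    that twisting by the identity maps w^2 to [G], so w^2 = 1. *)
Lemma sd_orth_surj gamma : exists p, sd_orth p = gamma.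
Proof.
case: gamma => gamma /= gB; have /BorthP hg := gB.
have [phi [phi_iso mphi]] := orth_occurs_iso hg.
have [c gE] := orth_zspan_tdiag hg nilG mphi.
pose w := \sum_(V : {group G}) coset_elt (phi @* V)%g *~ c V.
have gw : gamma = twist phi w.
  rewrite gE raddf_sum; apply: eq_big => [V|V _]; first by rewrite inE.
  by rewrite raddfMz /= twist_coset.
have [phi' [phiK phi'K]] := isom_inverse phi_iso.
have id_iso : isom [set: G] [set: G] (idm [set: G]).
  by apply: (@isom_cancel _ _ _ id).
have wU : w \is a GRing.unit.
  apply/unitrPr; exists w; apply: (twist_inj id_iso); rewrite twist_id1 -hg.2 gw.
  by rewrite (twist_bop _ phiK phi'K) (@twist_bmul _ _ _ _ _ (idm [set: G])).
have /isomP[phi_inj phi_im] := phi_iso.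
pose a := aut phi_inj phi_im.
have Aa : a \in Aut [set: G] := Aut_aut phi_inj phi_im.
have Na := subsetP (Aut_norm_inn G) a Aa.
pose x : Out G := subg _ (coset (inn G) a).
have [|d e] := coset_innP (out_rep_norm x) Na Aa.
  by rewrite coset_out_rep subgK// mem_quotient.
exists (Sub w wU, x); apply: val_inj; rewrite /= gw.
apply: (@twist_conj _ _ _ _ d) => g.
by rewrite /= autmE e /a autE ?inE.
Qed.
End SemidirectProduct.

Local Close Scope ring_scope.

Theorem theorem1p1 (G H : finGroupType) :
  [/\ (forall gamma : biburnside G H, gamma \in Bdelta G H ->
        bmul gamma (bop gamma) = bid G ->
        bmul (bop gamma) gamma = bid H /\ gamma \in Borth G H),
      finite_set [set gamma : biburnside G H | gamma \in Borth G H]%classic,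
      ((exists gamma : biburnside G H, gamma \in Borth G H) <->
        [set: G]%SET \isog [set: H]%SET),
      (forall gamma : biburnside G H, gamma \in Borth G H ->
        (exists phi : {morphism [set: H]%SET >-> G},
          [/\ isom [set: H]%SET [set: G]%SET phi,
              occurs (bcoset (tdiag phi [set: H]%SET)) gamma &
              forall psi : {morphism [set: H]%SET >-> G},
                isom [set: H]%SET [set: G]%SET psi ->
                occurs (bcoset (tdiag psi [set: H]%SET)) gamma ->
                exists g : G, forall h : H, psi h = (phi h ^ g)%g]) /\
        (nilpotent [set: G]%SET -> uniform gamma))
    & (nilpotent [set: G]%SET ->
        exists f : orth_group G -> burnside_sdprod G,
          bijective f /\ {morph f : x y / (x * y)%g >-> (x * y)%g})].
Proof.
have nilH : nilpotent [set: G]%SET -> forall gamma : biburnside G H,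
    half_orth gamma -> nilpotent [set: H]%SET.
  move=> nilG gamma /half_orth_iso[phi [/isomP[_ <-] _]].
  exact: morphim_nil.
split.
- by move=> gamma gB gg; split; [apply: half_orth_bop | apply/BorthP].
- by apply: sub_finite_set (half_orth_finite G H) => gamma /BorthP.
- split=> [[gamma /BorthP/half_orth_iso[phi [phi_iso _]]]|].
    exact: isom_isog phi_iso.
  rewrite isog_sym => /isogP[phi phi_inj phi_im].
  exists (twist phi 1%R); apply/BorthP/half_orth_twist; last exact: mulr1.
  exact/isomP.
- move=> gamma /BorthP hg; split.
    have [phi [phi_iso mphi]] := orth_occurs_iso hg.
    have occ (psi : {morphism [set: H]%SET >-> G}) :
        occurs (bcoset (tdiag psi [set: H]%SET)) gamma <->
        mark (graph psi id) gamma != 0%R.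
      by rewrite (occurs_mark hg.1) tdiag_full.
    exists phi; split=> // [|psi _ /occ mpsi]; first exact/occ.
    have hom (f : {morphism [set: H]%SET >-> G}) :
      {morph f : s t / (s * t)%g} by move=> s t; rewrite morphM ?inE.
    have [_ col] := half_orth_col hg (hom phi) (fun _ _ => erefl) mphi.
    exact: col (hom psi) mpsi.
  move=> nilG; have [phi [phi_iso mphi]] := orth_occurs_iso hg.
  exists phi => //; have [c ->] := orth_zspan_tdiag hg (nilH nilG _ hg) mphi.
  by exists c; apply: eq_bigl => V; rewrite inE.
move=> nilG; have ex (gamma : orth_group G) : exists p, sd_orth p == gamma.
  by have [p <-] := sd_orth_surj nilG gamma; exists p.
have [f fK] : exists f : orth_group G -> burnside_sdprod G,
    cancel f (@sd_orth G).
  by exists (fun gamma => xchoose (ex gamma)) => x; apply/eqP/(xchooseP (ex x)).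
exists f; split; first by exists (@sd_orth G) => // p; apply: sd_orth_inj.
move=> x y; apply: sd_orth_inj; rewrite fK sd_orthM.
by rewrite (fK x) (fK y).
Qed.
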